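(* Every pseudomatricial C$^*$-algebra $A$ has strict comparison of projections: if $\mathrm{tr}$ is the unique tracial state of $A$ and $p,q\in A$ are projections with $\mathrm{tr}(q)<\mathrm{tr}(p)$, then $q$ is Murray-von Neumann equivalent to a proper subprojection of $p$.
   Context: Projections $p,q$ are Murray-von Neumann equivalent if $p=v^*v$, $q=vv^*$ for some $v\in A$. A pseudomatricial C$^*$-algebra has exactly one tracial state. $M_n$ denotes the C$^*$-algebra of complex $n\times n$ matrices, $n\ge 1$. Continuous logic for C$^*$-algebras: atomic formulae are norms $\|P(x_1,\dots,x_k)\|$ of $*$-polynomials with complex coefficients (a constant $I$ for the identity may be used when the algebras are unital); formulae are built from these by applying continuous real-valued functions to finitely many formulae and by taking $\sup$ or $\inf$ of a variable over the closed unit ball. A sentence is a formula without free variables; $\varphi^A\in\mathbb{R}$ is its value in $A$. $A\equiv B$ (elementarily equivalent) if $\varphi^A=\varphi^B$ for every sentence $\varphi$. For an ultrafilter $\mathcal{U}$ on a set $J$, the ultraproduct $\prod_{\mathcal{U}}A_i$ is the C$^*$-algebra of bounded families $(a_i)_{i\in J}$ modulo those with $\lim_{\mathcal{U}}\|a_i\|=0$. A C$^*$-algebra is pseudomatricial if it is elementarily equivalent to an ultraproduct of matrix algebras $M_n$; it is not required to be infinite-dimensional. Such algebras are unital. *)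

(* Defs.v *)
From HB Require Import structures.
From mathcomp Require Import all_boot all_order all_algebra generic_quotient.
From mathcomp Require Import complex ring.
From mathcomp Require Import boolp classical_sets functions reals interval_inference topology normedtype sequences.
Set Implicit Arguments. Unset Strict Implicit. Unset Printing Implicit Defensive.
Import Order.TTheory GRing.Theory Num.Theory numFieldNormedType.Exports.
Local Open Scope classical_set_scope.
Local Open Scope complex_scope.
Local Open Scope ring_scope.

Reserved Notation "x ** y" (at level 40, left associativity).

Lemma half_pow_lt (R : realType) (e : R) : 0 < e -> exists n, 2^-1 ^+ n < e.
Proof.
move=> e0; have [N _ H] := near_infty_natSinv_expn_lt (PosNum e0).
by exists N; have := H N (leqnn N); rewrite /= -exprVn mul1r.
Qed.

Lemma half_pow_ltC (R : realType) (e : R[i]) : 0 < e -> exists n, 2^-1 ^+ n < e.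
Proof.
case: e => a b; rewrite ltcE /= => /andP[/eqP b0 a0]; rewrite {}b0.
have [n hn] := half_pow_lt a0; exists n.
suff -> : (2^-1 ^+ n : R[i]) = (2^-1 ^+ n)%:C by rewrite ltcE /= eqxx.
by rewrite rmorphXn /= fmorphV /= rmorph_nat.
Qed.

Section FastCauchy.
Variables (K : numFieldType) (V : normedModType K).

(* Fast Cauchy sequences: completeness of a normed module in the sense of
   filters reduces to the convergence of these. *)
Definition fast (u : nat -> V) := forall n, `|u n.+1 - u n| <= 2^-1 ^+ n.

Lemma fast_dist u : fast u -> forall n m, `|u (n + m)%N - u n| <= 2 * 2^-1 ^+ n.
Proof.
move=> fu n m.
suff : `|u (n + m)%N - u n| <= 2 * 2^-1 ^+ n - 2 * 2^-1 ^+ (n + m).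
  move=> h; apply: (le_trans h); by rewrite gerBl mulr_ge0.
elim: m => [|m IH]; first by rewrite addn0 !subrr normr0.
rewrite addnS -(subrKA (u (n + m)%N)); apply: (le_trans (ler_normD _ _)).
apply: (le_trans (lerD (fu _) IH)).
rewrite exprS mulrA divff ?pnatr_eq0// mul1r addrCA lerD2l.
by rewrite mulr_natl mulr2n opprD addrA subrr sub0r.
Qed.
End FastCauchy.

Lemma fast_limit (K : numFieldType) (V : completeNormedModType K)
    (arch : forall e : K, 0 < e -> exists n, 2^-1 ^+ n < e) (u : nat -> V) :
  fast u -> exists L : V, forall n, `|L - u n| <= 3 * 2^-1 ^+ n.
Proof.
move=> fu.
have near_u e : 0 < e -> exists N, forall m, `|u N - u (N + m)%N| < e.
  move=> e0; have [n hn] := arch (e / 2) ltac:(by rewrite divr_gt0).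
  exists n => m; rewrite distrC; apply: (le_lt_trans (fast_dist fu _ _)).
  by rewrite mulrC -ltr_pdivlMr.
have cu : cvg (u @ \oo).
  apply: cauchy_cvg; apply: cauchy_exP => e e0.
  have [N hN] := near_u _ e0; exists (u N).
  exists N => // m /= Nm; rewrite -ball_normE /= -(subnKC Nm); exact: hN.
exists (lim (u @ \oo)) => n.
have h0 : (0 : K) < 2^-1 ^+ n by rewrite exprn_gt0// invr_gt0.
have /cvgrPdist_lt/(_ _ h0)[N _ hN] : u @ \oo --> lim (u @ \oo) by [].
have := hN (n + N)%N (leq_addl _ _) => /= /ltW h.
rewrite -(subrKA (u (n + N)%N)); apply: (le_trans (ler_normD _ _)).
apply: (le_trans (lerD h (fast_dist fu n N))).
by rewrite -{1}(mul1r (2^-1 ^+ n)) -mulrDl.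
Qed.

Lemma fast_complete (R : realType) (V : normedModType R[i]) :
  (forall u : nat -> V, fast u ->
     exists c, exists L : V, forall n, `|L - u n| <= c * 2^-1 ^+ n) ->
  forall F : set_system V, ProperFilter F -> cauchy F -> cvg F.
Proof.
move=> H F FF /cauchyP cF.
have q0 n : (0 : R[i]) < 2^-1 ^+ n by rewrite exprn_gt0// invr_gt0.
have /choice[x hx] : forall n, exists y, F (ball y (2^-1 ^+ n.+2 : R[i])).
  by move=> n; apply: cF.
have fx : fast x.
  move=> n; have [y []] := filter_ex (filterI (hx n.+1) (hx n)).
  rewrite -!ball_normE /= => h1 h2.
  rewrite -(subrKA y); apply: (le_trans (ler_normD _ _)).
  rewrite (distrC y); apply: (le_trans (lerD (ltW h1) (ltW h2))).
  have hle m : (2^-1 ^+ m.+1 : R[i]) <= 2^-1 ^+ m.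
    by rewrite exprS ler_piMl ?(ltW (q0 _))// invf_le1// ler1n.
  have -> : (2^-1 ^+ n : R[i]) = 2^-1 ^+ n.+1 + 2^-1 ^+ n.+1.
    by rewrite [LHS]splitr exprS mulrC.
  by apply: lerD; [exact: le_trans (hle _) (hle _) | exact: hle].
have [c [L hL]] := H x fx.
apply/cvg_ex; exists L; apply/cvgrPdist_lt => e e0.
have c0 : 0 <= c.
  by have := le_trans (normr_ge0 _) (hL 0%N); rewrite expr0 mulr1.
have [n hn] := half_pow_ltC (divr_gt0 e0 (ltr_wpDl c0 ltr01)).
near=> y.
have hy : `|x n - y| < 2^-1 ^+ n.+2.
  by near: y; have := hx n; rewrite -ball_normE.
rewrite -(subrKA (x n)); apply: (le_lt_trans (ler_normD _ _)).
apply: (le_lt_trans (lerD (hL n) (ltW hy))).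
apply: (@le_lt_trans _ _ ((c + 1) * 2^-1 ^+ n)).
  rewrite mulrDl mul1r lerD2l !exprS !mulrA ler_piMl ?(ltW (q0 _))//.
  by rewrite -invfM invf_le1 ?mulr_gt0// -natrM ler1n.
by rewrite mulrC -ltr_pdivlMr// ltr_wpDl.
Unshelve. all: by end_near.
Qed.

(* C*-algebras are not required to be unital.  In a normed module over R[i]
   the norm takes values in R[i]; [cnorm] below is its value in R. *)
HB.mixin Record isCStarAlgebra (R : realType) A & CompleteNormedModule R[i] A := {
  cmul : A -> A -> A;
  star : A -> A;
  cmulA : associative cmul;
  cmulDl : left_distributive cmul +%R;
  cmulDr : right_distributive cmul +%R;
  cscaleAl : forall (k : R[i]) (x y : A), k *: cmul x y = cmul (k *: x) y;
  cscaleAr : forall (k : R[i]) (x y : A), k *: cmul x y = cmul x (k *: y);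
  starK : involutive star;
  starD : {morph star : x y / x + y};
  starZ : forall (k : R[i]) (x : A), star (k *: x) = k^* *: star x;
  starM : forall x y : A, star (cmul x y) = cmul (star y) (star x);
  cnormM : forall x y : A, `|cmul x y| <= `|x| * `|y|;
  cnorm_star : forall x : A, `|cmul (star x) x| = `|x| ^+ 2
}.

#[short(type="cstarAlgType")]
HB.structure Definition CStarAlgebra (R : realType) :=
  {A of CompleteNormedModule R[i] A & isCStarAlgebra R A}.

Notation "x ** y" := (cmul x y) : ring_scope.

Definition cnorm (R : realType) (V : normedModType R[i]) (x : V) : R :=
  complex.Re `|x|.

Import Normc.

Section EuclideanNorm.
Variable R : realType.
Local Notation nc := (@normc R).

Definition vnorm n (x : 'cV[R[i]]_n) : R :=
  Num.sqrt (\sum_i normc (x i 0) ^+ 2).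

Lemma normcC (z : R[i]) : `|z| = (nc z)%:C. Proof. by []. Qed.
Lemma normc_ge0 (z : R[i]) : 0 <= nc z.
Proof. by case: z => a b; exact: sqrtr_ge0. Qed.
Lemma normc_conj (z : R[i]) : nc (z^*) = nc z.
Proof. by case: z => a b /=; rewrite sqrrN. Qed.

Lemma sum_sqr_ge0 n (a : 'I_n -> R) : 0 <= \sum_i a i ^+ 2.
Proof. by apply: sumr_ge0 => i _; exact: sqr_ge0. Qed.

Lemma CauchySchwarzR n (a b : 'I_n -> R) :
  \sum_i a i * b i <= Num.sqrt (\sum_i a i ^+ 2) * Num.sqrt (\sum_i b i ^+ 2).
Proof.
set A := \sum_i a i ^+ 2; set B := \sum_i b i ^+ 2; set C := \sum_i a i * b i.
have A0 : 0 <= A by exact: sum_sqr_ge0.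
have B0 : 0 <= B by exact: sum_sqr_ge0.
have key : 0 <= B * (A * B - C ^+ 2).
  suff <- : \sum_i (B * a i - C * b i) ^+ 2 = B * (A * B - C ^+ 2).
    exact: sum_sqr_ge0.
  transitivity (\sum_i (B ^+ 2 * a i ^+ 2 - (2 * B * C) * (a i * b i)
                        + C ^+ 2 * b i ^+ 2)).
    by apply: eq_bigr => i _; ring.
  by rewrite big_split /= sumrB -!mulr_sumr -/A -/B -/C; ring.
have CAB : C ^+ 2 <= A * B.
  have [B1|] := ltP 0 B; first by rewrite -subr_ge0 -(pmulr_rge0 _ B1).
  move=> B1; have B2 : B = 0 by apply: le_anti; rewrite B1 B0.
  have b0 i : b i = 0.
    apply/eqP; rewrite -sqrf_eq0; apply/eqP.
    by apply: (psumr_eq0P _ B2) => // j _; exact: sqr_ge0.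
  have -> : C = 0 by rewrite /C big1// => i _; rewrite b0 mulr0.
  by rewrite expr0n /= mulr_ge0.
rewrite -sqrtrM//; apply: (le_trans (ler_norm _)).
by rewrite -sqrtr_sqr ler_sqrt// mulr_ge0.
Qed.

Lemma vnorm_ge0 n (x : 'cV[R[i]]_n) : 0 <= vnorm x. Proof. exact: sqrtr_ge0. Qed.

Lemma sqr_vnorm n (x : 'cV[R[i]]_n) : vnorm x ^+ 2 = \sum_i nc (x i 0) ^+ 2.
Proof. by rewrite sqr_sqrtr// sum_sqr_ge0. Qed.

Lemma vnorm0 n : vnorm (0 : 'cV[R[i]]_n) = 0.
Proof.
by rewrite /vnorm big1 ?sqrtr0// => i _; rewrite mxE normc0 expr0n.
Qed.

Lemma entry_vnorm n (x : 'cV[R[i]]_n) i : nc (x i 0) <= vnorm x.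
Proof.
rewrite -(@ler_pXn2r _ 2) ?nnegrE ?normc_ge0 ?vnorm_ge0// sqr_vnorm.
by rewrite (bigD1 i)//= lerDl; apply: sumr_ge0 => j _; exact: sqr_ge0.
Qed.

Lemma vnorm_eq0 n (x : 'cV[R[i]]_n) : vnorm x = 0 -> x = 0.
Proof.
move=> x0; apply/matrixP => i j; rewrite (ord1 j) mxE; apply: eq0_normc.
by apply: le_anti; rewrite normc_ge0 -x0 entry_vnorm.
Qed.

Lemma vnormZ n (k : R[i]) (x : 'cV[R[i]]_n) : vnorm (k *: x) = nc k * vnorm x.
Proof.
rewrite /vnorm; under eq_bigr do rewrite mxE normcM exprMn.
by rewrite -mulr_sumr sqrtrM ?sqr_ge0// sqrtr_sqr ger0_norm ?normc_ge0.
Qed.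

Lemma vnormD n (x y : 'cV[R[i]]_n) : vnorm (x + y) <= vnorm x + vnorm y.
Proof.
rewrite -(@ler_pXn2r _ 2) ?nnegrE ?addr_ge0 ?vnorm_ge0// sqrrD !sqr_vnorm.
apply: (@le_trans _ _ (\sum_i (nc (x i 0) + nc (y i 0)) ^+ 2)).
  apply: ler_sum => i _; rewrite ler_pXn2r ?nnegrE ?addr_ge0 ?normc_ge0//.
  by rewrite mxE le_normcD.
under eq_bigr do rewrite sqrrD.
rewrite 2!big_split /= lerD2r lerD2l sumrMnl lerMn2r /=.
exact: CauchySchwarzR.
Qed.

Lemma vnorm_sum n (I : finType) (x : I -> 'cV[R[i]]_n) :
  vnorm (\sum_i x i) <= \sum_i vnorm (x i).
Proof.
elim/big_ind2 : _ => [|a b c d h1 h2|//]; first by rewrite vnorm0.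
exact: le_trans (vnormD _ _) (lerD h1 h2).
Qed.

(* The operator norm for the Euclidean norms; see [opnorm_has_sup]. *)
Definition opnorm m n (M : 'M[R[i]]_(m, n)) : R :=
  sup [set vnorm (M *m x) | x in [set x | vnorm x <= 1]].

Lemma mulmx_cols m n (M : 'M[R[i]]_(m, n)) x : M *m x = \sum_j x j 0 *: col j M.
Proof.
apply/matrixP => i k; rewrite (ord1 k) !mxE summxE; apply: eq_bigr => j _.
by rewrite !mxE mulrC.
Qed.

Lemma opnorm_sum m n (M : 'M[R[i]]_(m, n)) (x : 'cV[R[i]]_n) :
  vnorm (M *m x) <= (\sum_j vnorm (col j M)) * vnorm x.
Proof.
rewrite mulmx_cols; apply: (le_trans (vnorm_sum _)); rewrite mulr_suml.
apply: ler_sum => j _; rewrite vnormZ mulrC ler_wpM2l ?vnorm_ge0//.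
exact: entry_vnorm.
Qed.

Lemma opnorm_has_sup m n (M : 'M[R[i]]_(m, n)) :
  has_sup [set vnorm (M *m x) | x in [set x | vnorm x <= 1]].
Proof.
split; first by exists (vnorm (M *m 0)); exists 0; rewrite //= vnorm0.
exists (\sum_j vnorm (col j M)) => _ [x /= x1 <-].
apply: (le_trans (opnorm_sum _ _)); rewrite ler_piMr//.
by apply: sumr_ge0 => j _; exact: vnorm_ge0.
Qed.

Lemma opnorm_le m n (M : 'M[R[i]]_(m, n)) x :
  vnorm (M *m x) <= opnorm M * vnorm x.
Proof.
have [/vnorm_eq0 ->|x0] := eqVneq (vnorm x) 0.
  by rewrite mulmx0 !vnorm0 mulr0.
have xp : 0 < vnorm x by rewrite lt_def x0 vnorm_ge0.
have nV : nc ((vnorm x)^-1)%:C = (vnorm x)^-1.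
  by rewrite /= expr0n/= addr0 sqrtr_sqr ger0_norm// invr_ge0 ltW.
rewrite -ler_pdivrMr// mulrC -{1}nV -vnormZ scalemxAr.
apply: sup_upper_bound; first exact: opnorm_has_sup.
by exists (((vnorm x)^-1)%:C *: x) => //=; rewrite vnormZ nV mulVf.
Qed.

Lemma opnorm_lub m n (M : 'M[R[i]]_(m, n)) c : 0 <= c ->
  (forall x, vnorm (M *m x) <= c * vnorm x) -> opnorm M <= c.
Proof.
move=> c0 H; apply: ge_sup; first by case: (opnorm_has_sup M).
by move=> _ [x /= x1 <-]; apply: (le_trans (H x)); rewrite ler_piMr.
Qed.

Lemma opnorm_ge0 m n (M : 'M[R[i]]_(m, n)) : 0 <= opnorm M.
Proof.
apply: sup_upper_bound; first exact: opnorm_has_sup.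
by exists 0; rewrite /= ?vnorm0// mulmx0 vnorm0.
Qed.

Lemma opnormD m n (M N : 'M[R[i]]_(m, n)) : opnorm (M + N) <= opnorm M + opnorm N.
Proof.
apply: opnorm_lub => [|x]; first by rewrite addr_ge0 ?opnorm_ge0.
rewrite mulmxDl mulrDl; apply: (le_trans (vnormD _ _)).
by apply: lerD; exact: opnorm_le.
Qed.

Lemma opnormZ m n k (M : 'M[R[i]]_(m, n)) : opnorm (k *: M) = nc k * opnorm M.
Proof.
have le k' (N : 'M[R[i]]_(m, n)) : opnorm (k' *: N) <= nc k' * opnorm N.
  apply: opnorm_lub => [|x]; first by rewrite mulr_ge0 ?opnorm_ge0 ?normc_ge0.
  by rewrite -scalemxAl vnormZ -mulrA ler_wpM2l ?normc_ge0 ?opnorm_le.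
apply: le_anti; rewrite le /=.
have [->|k0] := eqVneq k 0; first by rewrite normc0 mul0r opnorm_ge0.
rewrite -{1}(scalerK k0 M); apply: le_trans (ler_wpM2l (normc_ge0 _) (le _ _)) _.
by rewrite mulrA -normcM divff// normc1 mul1r.
Qed.

Lemma opnormM m n p (M : 'M[R[i]]_(m, n)) (N : 'M[R[i]]_(n, p)) :
  opnorm (M *m N) <= opnorm M * opnorm N.
Proof.
apply: opnorm_lub => [|x]; first by rewrite mulr_ge0 ?opnorm_ge0.
rewrite -mulmxA -mulrA; apply: (le_trans (opnorm_le _ _)).
by rewrite ler_wpM2l ?opnorm_ge0// opnorm_le.
Qed.

Lemma entry_opnorm m n (M : 'M[R[i]]_(m, n)) i j : nc (M i j) <= opnorm M.
Proof.
have d1 : vnorm (delta_mx j 0 : 'cV[R[i]]_n) = 1.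
  rewrite /vnorm (bigD1 j)//= big1 => [|k kj].
    by rewrite mxE !eqxx normc1 expr1n addr0 sqrtr1.
  by rewrite mxE (negbTE kj) normc0 expr0n.
have := opnorm_le M (delta_mx j 0); rewrite d1 mulr1; apply: le_trans.
by apply: le_trans (entry_vnorm _ i); rewrite -colE mxE.
Qed.

Lemma opnorm_eq0 m n (M : 'M[R[i]]_(m, n)) : opnorm M = 0 -> M = 0.
Proof.
move=> M0; apply/matrixP => i j; rewrite mxE; apply: eq0_normc.
by apply: le_anti; rewrite normc_ge0 -M0 entry_opnorm.
Qed.

Lemma opnorm_entries m n (M : 'M[R[i]]_(m, n)) c : 0 <= c ->
  (forall i j, nc (M i j) <= c) -> opnorm M <= (n * m)%:R * c.
Proof.
move=> c0 H; apply: opnorm_lub => [|x]; first by rewrite mulr_ge0.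
apply: (le_trans (opnorm_sum _ _)); rewrite ler_wpM2r ?vnorm_ge0//.
have col_le j : vnorm (col j M) <= m%:R * c.
  rewrite -(@ler_pXn2r _ 2) ?nnegrE ?vnorm_ge0 ?mulr_ge0// sqr_vnorm.
  apply: (@le_trans _ _ (\sum_(i < m) c ^+ 2)).
    apply: ler_sum => i _; rewrite ler_pXn2r ?nnegrE ?normc_ge0//.
    by rewrite mxE.
  rewrite sumr_const card_ord exprMn -(mulr_natl (c ^+ 2)) ler_wpM2r ?sqr_ge0//.
  by rewrite -natrX ler_nat -mulnn; case: (m) => // k; rewrite leq_pmulr.
apply: (le_trans (ler_sum _ (fun j _ => col_le j))).
by rewrite sumr_const card_ord -(mulr_natl (_ * c)) mulrA -natrM.
Qed.

(* [M ^t*] is the conjugate transpose. *)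
Local Open Scope sesquilinear_scope.

Lemma vnorm_dot n (x : 'cV[R[i]]_n) : (vnorm x ^+ 2)%:C = (x ^t* *m x) 0 0.
Proof.
rewrite sqr_vnorm rmorph_sum mxE; apply: eq_bigr => i _.
by rewrite !mxE rmorphXn /= -normcC mulrC -normCK.
Qed.

Lemma dot_le n (x y : 'cV[R[i]]_n) : nc ((x ^t* *m y) 0 0) <= vnorm x * vnorm y.
Proof.
apply: (le_trans _ (CauchySchwarzR _ _)); rewrite mxE.
elim/big_ind2 : _ => [|a b c d h1 h2|i _]; first by rewrite normc0.
  exact: le_trans (le_normcD _ _) (lerD h1 h2).
by rewrite normcM !mxE normc_conj.
Qed.

Lemma opnorm_sqr_le m n (M : 'M[R[i]]_(m, n)) : opnorm M ^+ 2 <= opnorm (M ^t* *m M).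
Proof.
have h : opnorm M <= Num.sqrt (opnorm (M ^t* *m M)).
  apply: opnorm_lub => [|x]; first exact: sqrtr_ge0.
  rewrite -(@ler_pXn2r _ 2) ?nnegrE ?mulr_ge0 ?sqrtr_ge0 ?vnorm_ge0//.
  rewrite exprMn (sqr_sqrtr (opnorm_ge0 _)).
  have -> : vnorm (M *m x) ^+ 2 = nc ((x ^t* *m ((M ^t* *m M) *m x)) 0 0).
    rewrite !mulmxA -mulmxA -map_mxM -trmx_mul -vnorm_dot.
    by rewrite /= expr0n/= addr0 sqrtr_sqr ger0_norm// sqr_ge0.
  apply: (le_trans (dot_le _ _)).
  by rewrite mulrC expr2 mulrA ler_wpM2r ?vnorm_ge0// opnorm_le.
rewrite -(sqr_sqrtr (opnorm_ge0 (M ^t* *m M))).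
by rewrite ler_pXn2r ?nnegrE ?sqrtr_ge0 ?opnorm_ge0.
Qed.

Lemma opnorm_adj m n (M : 'M[R[i]]_(m, n)) : opnorm (M ^t*) = opnorm M.
Proof.
have le p q (N : 'M[R[i]]_(p, q)) : opnorm N <= opnorm (N ^t*).
  have [->|N0] := eqVneq (opnorm N) 0; first exact: opnorm_ge0.
  have Np : 0 < opnorm N by rewrite lt_def N0 opnorm_ge0.
  rewrite -(ler_pM2r Np) -expr2; apply: (le_trans (opnorm_sqr_le _)).
  exact: opnormM.
by apply: le_anti; rewrite le andbT; have := le _ _ (M ^t*); rewrite trmxCK.
Qed.

Lemma opnorm_cstar m n (M : 'M[R[i]]_(m, n)) : opnorm (M ^t* *m M) = opnorm M ^+ 2.
Proof.
apply: le_anti; rewrite opnorm_sqr_le andbT expr2.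
by have := opnormM (M ^t*) M; rewrite opnorm_adj.
Qed.

End EuclideanNorm.

(* M_n.  An alias, because the library equips ['M_n] with the entrywise sup
   norm, which is not a C*-norm. *)
Definition mxalg (R : realType) (n : nat) := 'M[R[i]]_n.

Section MatrixAlgebra.
Variables (R : realType) (n : nat).
Local Open Scope sesquilinear_scope.
Local Notation M := (mxalg R n).

HB.instance Definition _ := GRing.Lmodule.on M.

Let norm (x : M) : R[i] := (opnorm x)%:C.

Let ler_normD (x y : M) : norm (x + y) <= norm x + norm y.
Proof. by rewrite -rmorphD lecR; exact: opnormD. Qed.

Let normrZ (k : R[i]) (x : M) : norm (k *: x) = `|k| * norm x.
Proof. by rewrite normcC -rmorphM; congr (_%:C); exact: opnormZ. Qed.

Let normr0_eq0 (x : M) : norm x = 0 -> x = 0.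
Proof. by move=> [] /opnorm_eq0. Qed.

HB.instance Definition _ :=
  Lmodule_isNormed.Build R[i] M ler_normD normrZ normr0_eq0.

Let complete (F : set_system M) : ProperFilter F -> cauchy F -> cvg F.
Proof.
apply: fast_complete => u fu.
have q2 k : (2^-1 ^+ k : R[i]) = (2^-1 ^+ k)%:C.
  by rewrite rmorphXn /= fmorphV /= rmorph_nat.
have fe i j k : normc (u k.+1 i j - u k i j) <= 2^-1 ^+ k.
  have := fu k; rewrite q2 lecR; apply: le_trans.
  have := entry_opnorm (u k.+1 - u k : 'M[R[i]]_n) i j.
  by rewrite !mxE.
have lim_entry i j : exists z : R[i], forall k,
    normc (z - u k i j) <= 6 * 2^-1 ^+ k.
  have [] := @fast_limit _ R^o (@half_pow_lt R) (fun k => complex.Re (u k i j)).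
    move=> k; apply: le_trans (fe i j k).
    case: (u k.+1 i j) (u k i j) => a b [c d] /=.
    by rewrite -(sqrtr_sqr (a - c)) ler_sqrt ?addr_ge0 ?sqr_ge0// lerDl sqr_ge0.
  move=> a ha.
  have [] := @fast_limit _ R^o (@half_pow_lt R) (fun k => complex.Im (u k i j)).
    move=> k; apply: le_trans (fe i j k).
    case: (u k.+1 i j) (u k i j) => c b [e d] /=.
    by rewrite -(sqrtr_sqr (b - d)) ler_sqrt ?addr_ge0 ?sqr_ge0// lerDr sqr_ge0.
  move=> b hb; exists (a +i* b) => k.
  have -> : (6 : R) * 2^-1 ^+ k = 3 * 2^-1 ^+ k + 3 * 2^-1 ^+ k.
    by rewrite -mulrDl; congr (_ * _); rewrite -natrD.
  apply: le_trans (lerD (ha k) (hb k)).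
  case: (u k i j) => c d /=.
  rewrite -[leRHS]ger0_norm ?addr_ge0 ?normr_ge0// -[leRHS]sqrtr_sqr.
  rewrite ler_sqrt ?sqr_ge0// [leRHS]sqrrD !real_normK ?num_real// addrAC lerDl.
  by rewrite mulrn_wge0// mulr_ge0.
have /choice[L hL] : forall p : 'I_n * 'I_n, exists z : R[i], forall k,
    normc (z - u k p.1 p.2) <= 6 * 2^-1 ^+ k.
  by case=> i j; exact: lim_entry.
exists (((n * n)%:R * 6)%:C), (\matrix_(i, j) L (i, j) : M) => k.
rewrite q2 -rmorphM lecR -mulrA; apply: opnorm_entries => [|i j].
  by rewrite mulr_ge0// exprn_ge0// invr_ge0.
by rewrite !mxE; exact: (hL (i, j)).
Qed.

HB.instance Definition _ := Uniform_isComplete.Build M complete.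

Let mul (x y : M) : M := x *m y.
Let adj (x : M) : M := x ^t*.

Let mulA : associative mul. Proof. exact: mulmxA. Qed.
Let mulDl : left_distributive mul +%R. Proof. exact: mulmxDl. Qed.
Let mulDr : right_distributive mul +%R. Proof. exact: mulmxDr. Qed.
Let mulZl (k : R[i]) x y : k *: mul x y = mul (k *: x) y.
Proof. exact: scalemxAl. Qed.
Let mulZr (k : R[i]) x y : k *: mul x y = mul x (k *: y).
Proof. exact: scalemxAr. Qed.
Let adjK : involutive adj. Proof. exact: trmxCK. Qed.
Let adjD : {morph adj : x y / x + y}.
Proof. by move=> x y; rewrite /adj linearD map_mxD. Qed.
Let adjZ (k : R[i]) x : adj (k *: x) = k^* *: adj x.
Proof. by rewrite /adj linearZ /= map_mxZ. Qed.
Let adjM x y : adj (mul x y) = mul (adj y) (adj x).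
Proof. by rewrite /adj /mul trmx_mul map_mxM. Qed.
Let normM (x y : M) : `|mul x y| <= `|x| * `|y|.
Proof. by rewrite -rmorphM lecR; exact: opnormM. Qed.
Let norm_star (x : M) : `|mul (adj x) x| = `|x| ^+ 2.
Proof. by rewrite -rmorphXn; congr (_%:C); exact: opnorm_cstar. Qed.

HB.instance Definition _ := isCStarAlgebra.Build R M mulA mulDl mulDr mulZl
  mulZr adjK adjD adjZ adjM normM norm_star.

End MatrixAlgebra.


Section CnormTheory.
Variables (R : realType) (V : normedModType R[i]).
Implicit Types x y : V.

Lemma cnormE x : `|x| = (cnorm x)%:C.
Proof.
by rewrite /cnorm; have := normr_ge0 x; case: `|x| => a b; rewrite lecE /= => /andP[/eqP->].
Qed.

Lemma cnorm_le x y : (`|x| <= `|y|) = (cnorm x <= cnorm y).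
Proof. by rewrite !cnormE lecR. Qed.

Lemma cnorm_ge0 x : 0 <= cnorm x.
Proof. by have := normr_ge0 x; rewrite cnormE (lecR 0). Qed.

Lemma cnorm0 : cnorm (0 : V) = 0.
Proof. by rewrite /cnorm normr0. Qed.

Lemma cnormN x : cnorm (- x) = cnorm x.
Proof. by rewrite /cnorm normrN. Qed.

Lemma cdistrC x y : cnorm (x - y) = cnorm (y - x).
Proof. by rewrite /cnorm distrC. Qed.

Lemma cnormD x y : cnorm (x + y) <= cnorm x + cnorm y.
Proof. by have := ler_normD x y; rewrite !cnormE -rmorphD lecR. Qed.

Lemma cnormZ (k : R[i]) x : cnorm (k *: x) = Normc.normc k * cnorm x.
Proof. by rewrite /cnorm normrZ cnormE normcC -rmorphM. Qed.

Lemma cdist_norm x y : `|cnorm x - cnorm y| <= cnorm (x - y).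
Proof.
rewrite ler_norml; apply/andP; split.
  rewrite lerNl opprB lerBlDr cdistrC.
  by apply: le_trans (cnormD _ _); rewrite subrK.
by rewrite lerBlDr; apply: le_trans (cnormD _ _); rewrite subrK.
Qed.
End CnormTheory.

Section CnormAlg.
Variables (R : realType) (A : cstarAlgType R).
Implicit Types x y : A.

Lemma cnorm_mul x y : cnorm (x ** y) <= cnorm x * cnorm y.
Proof. by have := cnormM x y; rewrite !cnormE -rmorphM lecR. Qed.

Lemma cnorm_starx x : cnorm (star x ** x) = cnorm x ^+ 2.
Proof. by have := cnorm_star x; rewrite !cnormE -rmorphXn => -[]. Qed.

Lemma cnorm_adj x : cnorm (star x) = cnorm x.
Proof.
have le (z : A) : cnorm z <= cnorm (star z).
  have [->|z0] := eqVneq (cnorm z) 0; first exact: cnorm_ge0.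
  have zp : 0 < cnorm z by rewrite lt_def z0 cnorm_ge0.
  rewrite -(ler_pM2r zp) -expr2 -cnorm_starx.
  exact: cnorm_mul.
by apply: le_anti; rewrite le andbT; have := le (star x); rewrite starK.
Qed.

Lemma cmul0r x : 0 ** x = 0.
Proof. by have := cscaleAl 0 0 x; rewrite !scale0r. Qed.

Lemma cmulr0 x : x ** 0 = 0.
Proof. by have := cscaleAr 0 x 0; rewrite !scale0r. Qed.

Lemma cmulBl x y z : (x - y) ** z = x ** z - y ** z.
Proof. by rewrite cmulDl -scaleN1r -cscaleAl scaleN1r. Qed.

Lemma cmulBr x y z : z ** (x - y) = z ** x - z ** y.
Proof. by rewrite cmulDr -scaleN1r -cscaleAr scaleN1r. Qed.

Lemma starN x : star (- x) = - star x.
Proof. by rewrite -scaleN1r starZ rmorphN1 scaleN1r. Qed.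

Lemma starB x y : star (x - y) = star x - star y.
Proof. by rewrite starD starN. Qed.
End CnormAlg.

(* Bounded functions converge along ultrafilters. *)
Lemma ultra_cvg (R : realType) (J : Type) (U : set_system J) (UU : UltraFilter U)
    (f : J -> R) (c : R) : (forall i, `|f i| <= c) -> cvg (f i @[i --> U]).
Proof.
move=> fc.
have PU : ProperFilter (f i @[i --> U]) by exact: fmap_proper_filter.
have [] := @segment_compact R (- c) c _ PU.
  by apply: (@filterE _ U) => i /=; rewrite in_itv /= -ler_norml; exact: fc.
move=> l [_ cl]; apply/cvg_ex; exists l => B Bl.
have [//|UB] := in_ultra_setVsetC (f @^-1` B) UU.
by have [x []] := cl (~` B) B UB Bl.
Qed.

Lemma filter_le_lim (R : realType) (J : Type) (U : set_system J)
    (PU : ProperFilter U) (f g : J -> R) (l m : R) :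
  f i @[i --> U] --> l -> g i @[i --> U] --> m -> (forall i, f i <= g i) -> l <= m.
Proof.
move=> hf hg fg; have h : g i - f i @[i --> U] --> m - l by exact: cvgB.
rewrite -subr_ge0 -(cvg_lim (@Rhausdorff R) h).
apply: limr_ge; first by apply/cvg_ex; eexists; exact: h.
by apply: filterE => i; rewrite subr_ge0; exact: fg.
Qed.

Section Ultraproduct.
Variables (R : realType) (J : Type) (U : set_system J).

Record bounded_family (A : J -> cstarAlgType R) := BoundedFamily {
  family_of :> forall i, A i;
  family_bounded : exists c : R, forall i, cnorm (family_of i) <= c }.

Variables (UU : UltraFilter U) (A : J -> cstarAlgType R).
Local Notation fam := (bounded_family A).
Implicit Types a b : fam.

HB.instance Definition _ := gen_eqMixin fam.
HB.instance Definition _ := gen_choiceMixin fam.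

Definition ultranorm a : R := lim (cnorm (a i) @[i --> U]).

Lemma bounded0 : exists c : R, forall i : J, cnorm (0 : A i) <= c.
Proof. by exists 0 => i; rewrite cnorm0. Qed.

Lemma boundedD a b : exists c : R, forall i, cnorm (a i + b i) <= c.
Proof.
case: (family_bounded a) (family_bounded b) => c hc [d hd]; exists (c + d) => i.
exact: le_trans (cnormD _ _) (lerD (hc i) (hd i)).
Qed.

Lemma boundedN a : exists c : R, forall i, cnorm (- a i) <= c.
Proof. by case: (family_bounded a) => c hc; exists c => i; rewrite cnormN. Qed.

Lemma boundedZ k a : exists c : R, forall i, cnorm (k *: a i) <= c.
Proof.
case: (family_bounded a) => c hc; exists (Normc.normc k * c) => i.
by rewrite cnormZ ler_wpM2l ?normc_ge0.
Qed.

Lemma boundedM a b : exists c : R, forall i, cnorm (a i ** b i) <= c.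
Proof.
case: (family_bounded a) (family_bounded b) => c hc [d hd]; exists (c * d) => i.
by apply: le_trans (cnorm_mul _ _) _; rewrite ler_pM ?cnorm_ge0.
Qed.

Lemma boundedS a : exists c : R, forall i, cnorm (star (a i)) <= c.
Proof. by case: (family_bounded a) => c hc; exists c => i; rewrite cnorm_adj. Qed.

Definition fam0 : fam := BoundedFamily bounded0.
Definition famD a b : fam := BoundedFamily (boundedD a b).
Definition famN a : fam := BoundedFamily (boundedN a).
Definition famZ k a : fam := BoundedFamily (boundedZ k a).
Definition famM a b : fam := BoundedFamily (boundedM a b).
Definition famS a : fam := BoundedFamily (boundedS a).

Lemma ultranorm_cvg a : cnorm (a i) @[i --> U] --> ultranorm a.
Proof.
case: (family_bounded a) => c hc; apply: (ultra_cvg UU (c := c)) => i.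
by rewrite ger0_norm ?cnorm_ge0.
Qed.

Lemma ultranorm_eq a c : (cnorm (a i) @[i --> U] --> c) <-> ultranorm a = c.
Proof.
split=> [h|<-]; last exact: ultranorm_cvg.
by apply/cvg_lim => //; exact: Rhausdorff.
Qed.

Lemma ultranorm_le a b : (forall i, cnorm (a i) <= cnorm (b i)) ->
  ultranorm a <= ultranorm b.
Proof.
exact: (filter_le_lim _ (@ultranorm_cvg a) (@ultranorm_cvg b)).
Qed.

Lemma ultranorm_ge0 a : 0 <= ultranorm a.
Proof.
apply: limr_ge; first exact: ultranorm_cvg.
by apply: filterE => i; exact: cnorm_ge0.
Qed.

Lemma ultranormD a b : ultranorm (famD a b) <= ultranorm a + ultranorm b.
Proof.
have h : cnorm (a i) + cnorm (b i) @[i --> U] --> ultranorm a + ultranorm b.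
  by apply: cvgD; exact: ultranorm_cvg.
apply: (filter_le_lim _ (@ultranorm_cvg _) h) => i.
exact: cnormD.
Qed.

Lemma ultranormZ k a : ultranorm (famZ k a) = Normc.normc k * ultranorm a.
Proof.
apply/ultranorm_eq; under eq_fun do rewrite cnormZ.
by apply: cvgMl_tmp; exact: ultranorm_cvg.
Qed.

Lemma ultranormM a b : ultranorm (famM a b) <= ultranorm a * ultranorm b.
Proof.
have h : cnorm (a i) * cnorm (b i) @[i --> U] --> ultranorm a * ultranorm b.
  by apply: cvgM; exact: ultranorm_cvg.
apply: (filter_le_lim _ (@ultranorm_cvg _) h) => i.
exact: cnorm_mul.
Qed.

Lemma ultranormS a : ultranorm (famS a) = ultranorm a.
Proof. by congr (lim _); under eq_fun do rewrite cnorm_adj. Qed.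

Lemma ultranorm_star a : ultranorm (famM (famS a) a) = ultranorm a ^+ 2.
Proof.
apply/ultranorm_eq; under eq_fun do rewrite cnorm_starx expr2.
by apply: cvgM; exact: ultranorm_cvg.
Qed.

Lemma ultranorm0 a : (forall i, a i = 0) -> ultranorm a = 0.
Proof.
move=> h; apply/ultranorm_eq; under eq_fun do rewrite h cnorm0.
exact: cvg_cst.
Qed.

Lemma ultranorm_ext a b : (forall i, cnorm (a i) = cnorm (b i)) ->
  ultranorm a = ultranorm b.
Proof. by move=> h; congr (lim _); under eq_fun do rewrite h. Qed.

(* Two bounded families are identified when the norms of their differences
   tend to 0 along U; the norm of a class is [ultranorm] of any representative,
   see [ultra_normE]. *)
Definition null_diff : rel fam := fun a b =>
  `[< cnorm (a i - b i) @[i --> U] --> (0 : R) >].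

Lemma null_diffP a b : reflect (ultranorm (famD a (famN b)) = 0) (null_diff a b).
Proof. by apply: (iffP (asboolP _)) => [|] h; apply/(ultranorm_eq (famD a (famN b))). Qed.

Lemma null_diff_equiv : equiv_class_of null_diff.
Proof.
split=> [a|a b|b a c].
- by apply/null_diffP/ultranorm0 => i /=; rewrite subrr.
- apply/idP/idP => /null_diffP h; apply/null_diffP; rewrite -h;
    by apply: ultranorm_ext => i /=; rewrite cdistrC.
- move=> /null_diffP h1 /null_diffP h2; apply/null_diffP.
  apply: le_anti; rewrite ultranorm_ge0 andbT -[leRHS](addr0 0) -{1}h1 -h2.
  apply: le_trans (ultranormD _ _); apply: ultranorm_le => i /=.
  by rewrite subrKA.
Qed.

Canonical null_diff_eqrel := EquivRelPack null_diff_equiv.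

Definition ultraproduct := {eq_quot null_diff}%qT.

HB.instance Definition _ := Choice.on ultraproduct.
HB.instance Definition _ := Quotient.on ultraproduct.
Local Notation Q := ultraproduct.
Local Notation pi a := (\pi_Q a)%qT.

Lemma ultra_eqP a b : ultranorm (famD a (famN b)) = 0 <-> pi a = pi b.
Proof.
by split=> [/null_diffP h|/eqmodP/null_diffP//]; apply/eqmodP.
Qed.

Lemma ultra_ext a b : (forall i, a i = b i) -> pi a = pi b.
Proof. by move=> h; apply/ultra_eqP/ultranorm0 => i /=; rewrite h subrr. Qed.

Lemma ultra_repr a : ultranorm (famD (repr (pi a)) (famN a)) = 0.
Proof. by apply/ultra_eqP; rewrite reprK. Qed.

Let qle a b c : ultranorm b = 0 -> ultranorm c = 0 ->
  (forall i, cnorm (a i) <= cnorm (b i) + cnorm (c i)) -> ultranorm a = 0.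
Proof.
move=> b0 c0 h; apply: le_anti; rewrite ultranorm_ge0 andbT.
have hh : cnorm (b i) + cnorm (c i) @[i --> U] --> ultranorm b + ultranorm c.
  by apply: cvgD; exact: ultranorm_cvg.
move: hh; rewrite b0 c0 addr0 => hh.
exact: (filter_le_lim _ (@ultranorm_cvg a) hh).
Qed.

Definition ultra0 : Q := pi fam0.
Definition ultraD (x y : Q) : Q := pi (famD (repr x) (repr y)).
Definition ultraN (x : Q) : Q := pi (famN (repr x)).
Definition ultraZ k (x : Q) : Q := pi (famZ k (repr x)).
Definition ultraM (x y : Q) : Q := pi (famM (repr x) (repr y)).
Definition ultraS (x : Q) : Q := pi (famS (repr x)).

Lemma ultraDE a b : ultraD (pi a) (pi b) = pi (famD a b).
Proof.
apply/ultra_eqP; apply: (qle (ultra_repr a) (ultra_repr b)) => i /=.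
by rewrite opprD addrACA cnormD.
Qed.

Lemma ultraNE a : ultraN (pi a) = pi (famN a).
Proof.
apply/ultra_eqP; rewrite -(ultra_repr a); apply: ultranorm_ext => i /=.
by rewrite -opprD cnormN.
Qed.

Lemma ultraZE k a : ultraZ k (pi a) = pi (famZ k a).
Proof.
apply/ultra_eqP.
have <- : ultranorm (famZ k (famD (repr (pi a)) (famN a))) = 0.
  by rewrite ultranormZ ultra_repr mulr0.
by apply: ultranorm_ext => i /=; rewrite scalerBr.
Qed.

Lemma ultraSE a : ultraS (pi a) = pi (famS a).
Proof.
apply/ultra_eqP; rewrite -(ultra_repr a); apply: ultranorm_ext => i /=.
by rewrite -starB cnorm_adj.
Qed.

Lemma ultraME a b : ultraM (pi a) (pi b) = pi (famM a b).
Proof.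
have null0 c d : ultranorm c = 0 -> ultranorm (famM c d) = 0.
  move=> h; apply: le_anti; rewrite ultranorm_ge0 andbT.
  by apply: le_trans (ultranormM _ _) _; rewrite h mul0r.
have null1 c d : ultranorm d = 0 -> ultranorm (famM c d) = 0.
  move=> h; apply: le_anti; rewrite ultranorm_ge0 andbT.
  by apply: le_trans (ultranormM _ _) _; rewrite h mulr0.
apply/ultra_eqP.
apply: (qle (null0 _ (repr (pi b)) (ultra_repr a)) (null1 a _ (ultra_repr b))).
move=> i /=; apply: le_trans (cnormD _ _).
by rewrite cmulBl cmulBr subrKA.
Qed.

Let piP (P : Q -> Prop) : (forall a, P (pi a)) -> forall x, P x.
Proof. by move=> h x; rewrite -(reprK x). Qed.

Lemma ultraDA : associative ultraD.
Proof.
elim/piP => a; elim/piP => b; elim/piP => c; rewrite !ultraDE.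
by apply: ultra_ext => i /=; rewrite addrA.
Qed.
Lemma ultraDC : commutative ultraD.
Proof.
elim/piP => a; elim/piP => b; rewrite !ultraDE.
by apply: ultra_ext => i /=; rewrite addrC.
Qed.
Lemma ultra0D : left_id ultra0 ultraD.
Proof.
elim/piP => a; rewrite !ultraDE.
by apply: ultra_ext => i /=; rewrite add0r.
Qed.
Lemma ultraND : left_inverse ultra0 ultraN ultraD.
Proof.
elim/piP => a; rewrite ultraNE !ultraDE.
by apply: ultra_ext => i /=; rewrite addNr.
Qed.

HB.instance Definition _ :=
  GRing.isZmodule.Build Q ultraDA ultraDC ultra0D ultraND.

Let DE a b : pi a + pi b = pi (famD a b). Proof. exact: ultraDE. Qed.

Lemma ultraZA k l x : ultraZ k (ultraZ l x) = ultraZ (k * l) x.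
Proof.
elim/piP: x => a; rewrite !ultraZE.
by apply: ultra_ext => i /=; rewrite scalerA.
Qed.
Lemma ultra1Z : left_id 1 ultraZ.
Proof.
elim/piP => a; rewrite !ultraZE.
by apply: ultra_ext => i /=; rewrite scale1r.
Qed.
Lemma ultraZDr : right_distributive ultraZ +%R.
Proof.
move=> k; elim/piP => a; elim/piP => b.
rewrite !(ultraZE, DE).
by apply: ultra_ext => i /=; rewrite scalerDr.
Qed.
Lemma ultraZDl x : {morph ultraZ^~ x : k l / k + l}.
Proof.
elim/piP: x => a k l; rewrite !(ultraZE, DE).
by apply: ultra_ext => i /=; rewrite scalerDl.
Qed.

HB.instance Definition _ :=
  GRing.Zmodule_isLmodule.Build R[i] Q ultraZA ultra1Z ultraZDr ultraZDl.

Let NE a : - pi a = pi (famN a). Proof. exact: ultraNE. Qed.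
Let ZE k a : k *: pi a = pi (famZ k a). Proof. exact: ultraZE. Qed.

Let norm (x : Q) : R[i] := (ultranorm (repr x))%:C.

Let normE a : norm (pi a) = (ultranorm a)%:C.
Proof.
congr (_%:C); set b := repr _.
have h c d : ultranorm (famD c (famN d)) = 0 -> ultranorm c <= ultranorm d.
  move=> h; rewrite -[leRHS]add0r -h; apply: le_trans (ultranormD _ _).
  by apply: ultranorm_le => i /=; rewrite subrK.
apply: le_anti; apply/andP; split; apply: h; first exact: ultra_repr.
by rewrite -(ultra_repr a); apply: ultranorm_ext => i /=; rewrite cdistrC.
Qed.

Let qnormD x y : norm (x + y) <= norm x + norm y.
Proof.
elim/piP: x => a; elim/piP: y => b; rewrite DE !normE -rmorphD lecR.
exact: ultranormD.
Qed.

Let qnormZ k x : norm (k *: x) = `|k| * norm x.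
Proof.
by elim/piP: x => a; rewrite ZE !normE normcC -rmorphM ultranormZ.
Qed.

Let qnorm_eq0 x : norm x = 0 -> x = 0.
Proof.
elim/piP: x => a; rewrite normE => -[a0]; apply/ultra_eqP; rewrite -a0.
by apply: ultranorm_ext => i /=; rewrite subr0.
Qed.

HB.instance Definition _ :=
  Lmodule_isNormed.Build R[i] Q qnormD qnormZ qnorm_eq0.

Lemma ultra_normE a : `|pi a| = (ultranorm a)%:C. Proof. exact: normE. Qed.

Let lift_small (x : Q) (e : R) : 0 < e -> `|x| < e%:C ->
  exists2 a, pi a = x & forall i, cnorm (a i) <= e.
Proof.
move=> e0; elim/piP: x => a; rewrite ultra_normE ltcR => ae.
pose b i : A i := if cnorm (a i) <= e then a i else 0.
have be i : cnorm (b i) <= e by rewrite /b; case: ifP => // _; rewrite cnorm0; exact: ltW.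
have bb : exists c, forall i, cnorm (b i) <= c by exists e.
exists (BoundedFamily bb) => //; apply/ultra_eqP/ultranorm_eq.
apply: (@cvg_trans _ ((fun=> 0 : R) @ U)); last exact: cvg_cst.
apply: near_eq_cvg; near=> i; rewrite /= /b.
rewrite ifT ?subrr ?cnorm0//; apply: ltW; near: i.
exact: (cvgr_lt _ (@ultranorm_cvg a)).
Unshelve. all: by end_near. Qed.

Let complete (F : set_system Q) : ProperFilter F -> cauchy F -> cvg F.
Proof.
apply: fast_complete => u fu.
have q2 k : (2^-1 ^+ k : R[i]) = (2^-1 ^+ k)%:C.
  by rewrite rmorphXn /= fmorphV /= rmorph_nat.
have q0 k : (0 : R) < 2^-1 ^+ k by rewrite exprn_gt0// invr_gt0.
have /choice[d hd] : forall k, exists a : fam, pi a = 2^-1 *: (u k.+1 - u k) /\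
    forall i, cnorm (a i) <= 2^-1 ^+ k.
  move=> k; have [] := @lift_small (2^-1 *: (u k.+1 - u k)) (2^-1 ^+ k) (q0 k).
    rewrite normrZ gtr0_norm ?invr_gt0//.
    apply: (le_lt_trans (ler_wpM2l _ (fu k))); first by rewrite invr_ge0.
    by rewrite q2 -q2 gtr_pMl ?exprn_gt0 ?invr_gt0// invf_lt1// ltr1n.
  by move=> a h1 h2; exists a.
pose s k i : A i := \sum_(l < k) d l i.
have sf i : fast (fun k => s k i).
  move=> k; rewrite /s big_ord_recr /= addrAC subrr add0r cnormE q2 lecR.
  by case: (hd k).
have /(_ _)/cid-/all_sig[L hL] : forall i, exists z : A i, forall k,
    `|z - s k i| <= 3 * 2^-1 ^+ k.
  by move=> i; apply: fast_limit (sf i); exact: half_pow_ltC.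
have hLR i k : cnorm (L i - s k i) <= 3 * 2^-1 ^+ k.
  have := hL i k; rewrite cnormE q2.
  by rewrite -(rmorph_nat (real_complex R)) -rmorphM lecR.
have bL : exists c : R, forall i, cnorm (L i) <= c.
  by exists 3 => i; have := hLR i 0%N; rewrite /s big_ord0 subr0 mulr1.
have bs k : exists c : R, forall i, cnorm (s k i) <= c.
  elim: k => [|k [c hc]]; first by exists 0 => i; rewrite /s big_ord0 cnorm0.
  exists (c + 2^-1 ^+ k) => i; rewrite /s big_ord_recr /=.
  by apply: le_trans (cnormD _ _) (lerD (hc i) _); case: (hd k).
have us k : u k = u 0%N + 2 *: pi (BoundedFamily (bs k)).
  elim: k => [|k IH].
    have -> : pi (BoundedFamily (bs 0%N)) = 0.
      by apply: ultra_ext => i /=; rewrite /s big_ord0.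
    by rewrite scaler0 addr0.
  have -> : pi (BoundedFamily (bs k.+1)) = pi (BoundedFamily (bs k)) + pi (d k).
    by rewrite DE; apply: ultra_ext => i /=; rewrite /s big_ord_recr.
  rewrite scalerDr addrA -IH; case: (hd k) => -> _.
  by rewrite scalerA divff ?pnatr_eq0// scale1r addrC subrK.
exists (2 * 3), (u 0%N + 2 *: pi (BoundedFamily bL)) => k.
rewrite (us k) opprD addrACA subrr add0r -scalerBr normrZ -mulrA.
rewrite ger0_norm// ler_pM2l// NE DE ultra_normE q2.
rewrite -(rmorph_nat (real_complex R)) -rmorphM lecR.
apply: limr_le; first exact: ultranorm_cvg.
by apply: filterE => i; exact: hLR.
Qed.

HB.instance Definition _ := Uniform_isComplete.Build Q complete.

Let mulA : associative ultraM.
Proof.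
elim/piP => a; elim/piP => b; elim/piP => c; rewrite !ultraME.
by apply: ultra_ext => i /=; rewrite cmulA.
Qed.
Let mulDl : left_distributive ultraM +%R.
Proof.
elim/piP => a; elim/piP => b; elim/piP => c; rewrite !(DE, ultraME).
by apply: ultra_ext => i /=; rewrite cmulDl.
Qed.
Let mulDr : right_distributive ultraM +%R.
Proof.
elim/piP => a; elim/piP => b; elim/piP => c; rewrite !(DE, ultraME).
by apply: ultra_ext => i /=; rewrite cmulDr.
Qed.
Let mulZl (k : R[i]) x y : k *: ultraM x y = ultraM (k *: x) y.
Proof.
elim/piP: x => a; elim/piP: y => b; rewrite [in RHS]ZE !ultraME ZE.
by apply: ultra_ext => i /=; rewrite cscaleAl.
Qed.
Let mulZr (k : R[i]) x y : k *: ultraM x y = ultraM x (k *: y).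
Proof.
elim/piP: x => a; elim/piP: y => b; rewrite [in RHS]ZE !ultraME ZE.
by apply: ultra_ext => i /=; rewrite cscaleAr.
Qed.
Let adjK : involutive ultraS.
Proof.
elim/piP => a; rewrite !ultraSE.
by apply: ultra_ext => i /=; rewrite starK.
Qed.
Let adjD : {morph ultraS : x y / x + y}.
Proof.
elim/piP => a; elim/piP => b; rewrite !(DE, ultraSE).
by apply: ultra_ext => i /=; rewrite starD.
Qed.
Let adjZ (k : R[i]) x : ultraS (k *: x) = k^* *: ultraS x.
Proof.
elim/piP: x => a; rewrite [in LHS]ZE !ultraSE ZE.
by apply: ultra_ext => i /=; rewrite starZ.
Qed.
Let adjM x y : ultraS (ultraM x y) = ultraM (ultraS y) (ultraS x).
Proof.
elim/piP: x => a; elim/piP: y => b; rewrite !(ultraME, ultraSE).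
by apply: ultra_ext => i /=; rewrite starM.
Qed.
Let normM (x y : Q) : `|ultraM x y| <= `|x| * `|y|.
Proof.
elim/piP: x => a; elim/piP: y => b.
by rewrite ultraME !ultra_normE -rmorphM lecR ultranormM.
Qed.
Let norm_star (x : Q) : `|ultraM (ultraS x) x| = `|x| ^+ 2.
Proof.
elim/piP: x => a.
by rewrite ultraSE ultraME !ultra_normE -rmorphXn ultranorm_star.
Qed.

HB.instance Definition _ := isCStarAlgebra.Build R Q mulA mulDl mulDr mulZl
  mulZr adjK adjD adjZ adjM normM norm_star.

End Ultraproduct.

(* *-polynomials without constant term in n variables: the algebras need not
   have a unit, and the unit of a unital algebra is definable anyway. *)
Inductive starpoly (R : realType) (n : nat) : Type :=
| PVar of 'I_n
| PScale of R[i] & starpoly R n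
| PAdd of starpoly R n & starpoly R n
| PMul of starpoly R n & starpoly R n
| PStar of starpoly R n.

(* [formula R n] is the type of formulae with free variables among 'I_n; the
   variable bound by [FSup] or [FInf] is the one of index 0. *)
Inductive formula (R : realType) : nat -> Type :=
| FNorm n of starpoly R n : formula R n
| FConn n m (u : 'rV[R]_m -> R) of continuous u & ('I_m -> formula R n) :
    formula R n
| FSup n of formula R n.+1 : formula R n
| FInf n of formula R n.+1 : formula R n.

Section Semantics.
Variables (R : realType) (A : cstarAlgType R).

Definition unit_ball : set A := [set x | `|x| <= 1].

Fixpoint peval n (rho : 'I_n -> A) (P : starpoly R n) : A :=
  match P with
  | PVar i => rho i
  | PScale k P => k *: peval rho P
  | PAdd P Q => peval rho P + peval rho Q
  | PMul P Q => peval rho P ** peval rho Q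
  | PStar P => star (peval rho P)
  end.

Definition env_cons n (x : A) (rho : 'I_n -> A) : 'I_n.+1 -> A :=
  fun i => oapp rho x (unlift ord0 i).

(* The value of a formula is bounded when its variables range over bounded
   sets, so these suprema and infima are those of nonempty bounded sets. *)
Fixpoint feval n (phi : formula R n) : ('I_n -> A) -> R :=
  match phi in formula _ n return ('I_n -> A) -> R with
  | FNorm _ P => fun rho => cnorm (peval rho P)
  | FConn _ _ u _ phis => fun rho => u (\row_j feval (phis j) rho)
  | FSup _ phi => fun rho =>
      sup [set feval phi (env_cons x rho) | x in unit_ball]
  | FInf _ phi => fun rho =>
      inf [set feval phi (env_cons x rho) | x in unit_ball]
  end.

Definition sentence_value (phi : formula R 0) : R := feval phi (fun=> 0).

End Semantics.

Definition elementarily_equivalent (R : realType) (A B : cstarAlgType R) :=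
  forall phi : formula R 0, sentence_value A phi = sentence_value B phi.

Definition pseudomatricial (R : realType) (A : cstarAlgType R) :=
  exists (J : Type) (U : set_system J) (UU : UltraFilter U) (n : J -> nat),
    (forall i, (0 < n i)%N) /\
    elementarily_equivalent A (ultraproduct UU (fun i => mxalg R (n i))).

Section Projections.
Variables (R : realType) (A : cstarAlgType R).

Definition projection (p : A) := star p = p /\ p ** p = p.

Definition proper_subprojection (r p : A) :=
  [/\ projection r, p ** r = r & r <> p].

Definition mvn_equivalent (p q : A) :=
  exists v : A, p = star v ** v /\ q = v ** star v.

(* A state is a positive linear functional of norm 1. As [sup] of an unbounded
   set is 0, the middle condition includes that [tr] is bounded. *)
Definition tracial_state (tr : {scalar A}) :=
  [/\ forall a, 0 <= tr (star a ** a),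
      sup [set complex.Re `|tr a| | a in @unit_ball R A] = 1
    & forall a b, tr (a ** b) = tr (b ** a)].

End Projections.

(* Main.v *)
Require Import Defs.
From mathcomp Require Import all_boot all_order all_algebra.
From mathcomp Require Import generic_quotient lra.
From mathcomp Require Import complex boolp classical_sets reals.
From mathcomp Require Import topology normedtype.
Set Implicit Arguments.
Unset Strict Implicit.
Unset Printing Implicit Defensive.
Import Order.TTheory GRing.Theory Num.Theory numFieldNormedType.Exports.
Local Open Scope ring_scope.

(** In a matrix algebra any two projections are comparable: the one of smaller
    rank is equivalent to a subprojection of the other. Comparability passes
    from the algebras [M_n] to every algebra elementarily equivalent to an
    ultraproduct of them, and then the trace decides which of the two
    alternatives holds: if [p] were equivalent to a subprojection of [q], then
    [tr p <= tr q]. So [q] is equivalent to a subprojection [r] of [p], and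
    [r <> p] because [tr r = tr q < tr p].

    To pass comparability through elementary equivalence it is expressed by one
    sentence of continuous logic. With [a = x^* x] and [b = y^* y], which are
    [p] and [q] when [x = p] and [y = q] are projections, it reads
      [sup_x sup_y inf_v min (E a b v) (E b a v)
                         - 128 (|a^2 - a| + |b^2 - b|)]
    where [E a b v = |v^* v - b| + |a v - v|] measures how far [v] is from
    implementing an equivalence between [b] and a subprojection of [a]
    ([subequivalence_error]). Using [x^* x] makes [a] self-adjoint
    for every [x], and the subtracted term, the penalty, charges [a] and [b] for
    not being idempotent: it stands in for restricting [x] and [y] to
    projections, which a quantifier over the unit ball cannot do.

    The value is at most 1/4 in every [M_n] ([matrix_comparison]): if [a] and
    [b] are far from being idempotent then [v = 0] does; otherwise, by the
    spectral theorem, their eigenvalues lie near 0 or 1, and a partial isometry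
    carries eigenvectors of one for eigenvalues near 1 injectively to such
    eigenvectors of the other. As the bound is witnessed coordinatewise by
    contractions, it passes to ultraproducts ([ultraproduct_comparison]), and so
    to [A] by elementary equivalence. For projections [p], [q] of [A] it
    yields a contraction [v] with [E p q v <= 1/2] or [E q p v <= 1/2], and
    [exact_of_subequivalence_error] replaces it by an exact one: the
    Newton-Schulz iteration for the polar decomposition, started at [p v q],
    stays in [p A q] and converges to some [w] with [w^* w = q]. *)

(** * From approximate to exact subequivalence *)

Lemma normc_half (R : realType) : Normc.normc (2^-1 : R[i]) = 2^-1.
Proof.
apply: (@complexI R); rewrite -normcC fmorphV /= rmorph_nat.
by rewrite ger0_norm// invr_ge0 ler0n.
Qed.

Lemma half_pow_le1 (R : realType) n : (2^-1 ^+ n : R) <= 1.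
Proof. by rewrite exprn_ile1 ?invr_ge0 ?ler0n// invf_le1 ?ltr0n// ler1n. Qed.

Section Correction.
Variables (R : realType) (A : cstarAlgType R).
Implicit Types p q v w : A.

Definition subequivalence_error (a b v : A) : R :=
  cnorm (star v ** v - b) + cnorm (a ** v - v).

Lemma cnorm_mul_le (x y : A) (c d : R) :
  cnorm x <= c -> cnorm y <= d -> cnorm (x ** y) <= c * d.
Proof.
move=> xc yd; apply: le_trans (cnorm_mul _ _) _.
by apply: ler_pM => //; exact: cnorm_ge0.
Qed.

Lemma cnorm_projection_le1 p : projection p -> cnorm p <= 1.
Proof.
move=> [ps pp]; have := cnorm_starx p; rewrite ps pp.
have := cnorm_ge0 p; move: (cnorm p) => t t0 tt.
by rewrite leNgt; apply/negP => t1; clear ps pp; nra.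
Qed.

Definition isometry_defect q w : A := q - star w ** w.

(** One step of the Newton-Schulz iteration [w |-> w (3 - w^* w) / 2] for the
    polar decomposition, with [q] as the unit: it replaces the factor
    [(w^* w)^(-1/2)] of the isometric part of [w] by the linear part of its
    expansion at [q]. *)
Definition newton_step q w : A := w + w ** (2^-1 *: isometry_defect q w).

(** With [e] the old defect, [f = e / 2] commutes with [w^* w = q - 2 f], so the
    new defect is [q - (q - 2 f) (q + f)^2]: the terms of order 1 cancel, and
    the convergence is quadratic. Writing it with [f] keeps the coefficients
    integral, so that only the laws of an additive group are left to check. *)
Lemma newton_step_defect q w : projection q -> w ** q = w ->
  let f := 2^-1 *: isometry_defect q w in
  isometry_defect q (newton_step q w) =
  (f ** f + f ** f + f ** f) + (f ** f ** f + f ** f ** f).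
Proof.
move=> [qs qq] wq f.
have qw : q ** star w = star w by rewrite -{1}qs -starM wq.
have qf : q ** f = f.
  by rewrite -cscaleAr cmulBr qq cmulA qw.
have fq : f ** q = f.
  by rewrite -cscaleAl cmulBl qq -cmulA wq.
have fs : star f = f.
  by rewrite starZ starB starM starK qs fmorphV /= rmorph_nat.
have ww : star w ** w = q - (f + f).
  rewrite -scalerDl; have -> : (2^-1 + 2^-1 : R[i]) = 1.
    by rewrite [RHS]splitr mul1r.
  by rewrite scale1r subKr.
rewrite /isometry_defect /newton_step -/(isometry_defect q w) -/f.
rewrite starD starM fs cmulDl !cmulDr !cmulA ww -[f ** star w ** w]cmulA ww.
rewrite !(cmulBl, cmulBr) !(cmulDl, cmulDr) qf fq.
set F := f ** f; set G := F ** f.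
suff -> : q - (f + f) + (f - (F + F)) + ((f - (F + F)) + (F - (G + G))) =
    q - ((F + F + F) + (G + G)) by rewrite subKr.
rewrite [LHS]addrA -(addrA (q - _)) (addrACA f) -opprD subrKA.
by rewrite [F + F + (F + F)]addrA opprD [q + (_ - F)]addrA subrKA -addrA -opprD.
Qed.

(** Halving is all that the summability of the steps requires. It follows from
    [3 t^2 + 2 t^3 <= t] for [t = |f| <= 1/4]. *)
Lemma newton_step_defect_le q w : projection q -> w ** q = w ->
  cnorm (isometry_defect q w) <= 2^-1 ->
  cnorm (isometry_defect q (newton_step q w)) <=
    2^-1 * cnorm (isometry_defect q w).
Proof.
move=> hq wq small; rewrite newton_step_defect//.
set f := 2^-1 *: _; have f2 : cnorm f = 2^-1 * cnorm (isometry_defect q w).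
  by rewrite cnormZ normc_half.
rewrite -f2; have f4 : cnorm f <= 4^-1 by rewrite f2; clear -small; lra.
have F2 := cnorm_mul f f; have G2 := cnorm_mul (f ** f) f.
apply: le_trans (cnormD _ _) _.
apply: le_trans (lerD (cnormD _ _) (cnormD _ _)) _.
apply: le_trans (lerD (lerD (cnormD _ _) (lexx _)) (lexx _)) _.
have f0 := cnorm_ge0 f; move: (cnorm_ge0 (f ** f)) f0 f4 F2 G2.
move: (cnorm f) (cnorm (f ** f)) (cnorm (f ** f ** f)) => a b c.
clear; move=> b0 a0 a4 ba cb.
have ba' : b <= 4^-1 * a by apply: le_trans ba _; rewrite ler_wpM2r.
have cb' : c <= 4^-1 * b by apply: le_trans cb _; rewrite mulrC ler_wpM2r.
by lra.
Qed.

Fixpoint newton_iterate q w n : A :=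
  if n is n'.+1 then newton_step q (newton_iterate q w n') else w.

Lemma newton_iterateP p q w :
  projection q -> p ** w = w -> w ** q = w ->
  cnorm (isometry_defect q w) <= 2^-1 -> forall n,
  let wn := newton_iterate q w n in
  [/\ p ** wn = wn, wn ** q = wn &
      cnorm (isometry_defect q wn) <= 2^-1 ^+ n.+1].
Proof.
move=> hq pw wq small; elim=> [|n /= []].
  by split; rewrite ?expr1.
set wn := newton_iterate q w n => pwn wnq en; split.
- by rewrite cmulDr cmulA pwn.
- have [qs qq] := hq; rewrite cmulDl wnq -cmulA; congr (_ + _ ** _).
  by rewrite -cscaleAl cmulBl qq -cmulA wnq.
- have e2 : cnorm (isometry_defect q wn) <= 2^-1.
    apply: le_trans en _.
    by rewrite exprS ler_piMr ?invr_ge0 ?ler0n ?half_pow_le1.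
  apply: le_trans (newton_step_defect_le hq wnq e2) _.
  by rewrite [leRHS]exprS ler_wpM2l// invr_ge0 ler0n.
Qed.

Lemma eq0_of_half_pow (z : A) (c : R) :
  (forall n, cnorm z <= c * 2^-1 ^+ n) -> z = 0.
Proof.
move=> zc; suff z0 : cnorm z = 0.
  by apply/eqP; rewrite -normr_eq0 cnormE z0.
apply/eqP; rewrite eq_le cnorm_ge0 andbT leNgt; apply/negP => z1.
have c0 : 0 <= c by have := le_trans (cnorm_ge0 z) (zc 0%N); rewrite mulr1.
have [n hn] := half_pow_lt (divr_gt0 z1 (ltr_wpDl c0 ltr01)).
move: hn; rewrite ltr_pdivlMr ?ltr_wpDl// mulrC mulrDl mul1r => hn.
have h0 : (0 : R) < 2^-1 ^+ n by rewrite exprn_gt0// invr_gt0 ltr0n.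
have := le_lt_trans (zc n) (lt_trans _ hn).
by rewrite ltrDl h0 ltxx => /(_ isT).
Qed.

Lemma fast_cnorm_limit (u : nat -> A) :
  (forall n, cnorm (u n.+1 - u n) <= 2^-1 ^+ n) ->
  exists L, forall n, cnorm (L - u n) <= 3 * 2^-1 ^+ n.
Proof.
have half n : (2^-1 ^+ n : R[i]) = (2^-1 ^+ n)%:C%C.
  by rewrite rmorphXn /= fmorphV /= rmorph_nat.
move=> uf; have [|L hL] := @fast_limit _ A (@half_pow_ltC R) u.
  by move=> n; rewrite half cnormE lecR; exact: uf.
exists L => n; have := hL n.
by rewrite half cnormE -(rmorph_nat (real_complex R)) -rmorphM lecR.
Qed.

(** The iterates form a fast Cauchy sequence, since a step moves [w] by at most
    [|w| |e| / 2] and [|w| <= 2]; the relations [p w = w] and [w q = w] and the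
    vanishing of the defect pass to the limit. *)
Lemma exact_of_near_isometry p q w :
  projection q -> p ** w = w -> w ** q = w ->
  cnorm (isometry_defect q w) <= 2^-1 ->
  exists2 v, star v ** v = q & p ** v = v /\ v ** q = v.
Proof.
move=> hq pw wq small; pose u := newton_iterate q w.
have uP := newton_iterateP hq pw wq small.
have u2 n : cnorm (u n) <= 2.
  rewrite -(@ler_pXn2r _ 2) ?nnegrE ?cnorm_ge0 ?ler0n// -cnorm_starx.
  have [_ _ e1] := uP n.
  have -> : star (u n) ** u n = q - isometry_defect q (u n).
    by rewrite subKr.
  apply: le_trans (cnormD _ _) _; rewrite cnormN.
  apply: le_trans (lerD (cnorm_projection_le1 hq)
    (le_trans e1 (half_pow_le1 R _))) _.
  by clear; lra.
have [n|L hL] := @fast_cnorm_limit u.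
  have [_ _ en] := uP n; rewrite addrAC subrr add0r.
  apply: le_trans (cnorm_mul_le (u2 n) (lexx _)) _.
  rewrite cnormZ normc_half mulrA divff ?pnatr_eq0// mul1r.
  apply: le_trans en _; rewrite exprS ler_piMl ?exprn_ge0 ?invr_ge0 ?ler0n//.
  exact: (half_pow_le1 R 1).
exists L; last split.
- apply/eqP; rewrite eq_sym -subr_eq0; apply/eqP.
  apply: (@eq0_of_half_pow _ (1 + 3 * cnorm L + 2 * 3)) => n.
  have -> : q - star L ** L = isometry_defect q (u n)
      - (star (L - u n) ** L + star (u n) ** (L - u n)).
    rewrite starB cmulBl cmulBr addrA subrK /isometry_defect.
    by rewrite opprB addrA subrK.
  have [_ _ en] := uP n.
  apply: le_trans (cnormD _ _) _; rewrite cnormN.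
  rewrite (mulrDl (1 + _)) (mulrDl 1) mul1r -addrA; apply: lerD.
    apply: le_trans en _.
    rewrite exprS ler_piMl ?exprn_ge0 ?invr_ge0 ?ler0n//.
    exact: (half_pow_le1 R 1).
  apply: le_trans (cnormD _ _) _; apply: lerD.
    by rewrite mulrAC; apply: cnorm_mul_le; rewrite ?cnorm_adj ?hL.
  by rewrite -mulrA; apply: cnorm_mul_le; rewrite ?cnorm_adj ?u2 ?hL.
- apply/eqP; rewrite -subr_eq0; apply/eqP.
  apply: (@eq0_of_half_pow _ (cnorm p * 3 + 3)) => n.
  have [pu _ _] := uP n; have -> : p ** L - L = p ** (L - u n) - (L - u n).
    by rewrite cmulBr pu opprB addrA subrK.
  apply: le_trans (cnormD _ _) _; rewrite cnormN mulrDl.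
  apply: lerD; last exact: hL.
  by rewrite -mulrA; apply: cnorm_mul_le; rewrite ?hL.
- apply/eqP; rewrite -subr_eq0; apply/eqP.
  apply: (@eq0_of_half_pow _ (3 * cnorm q + 3)) => n.
  have [_ uq _] := uP n; have -> : L ** q - L = (L - u n) ** q - (L - u n).
    by rewrite cmulBl uq opprB addrA subrK.
  apply: le_trans (cnormD _ _) _; rewrite cnormN mulrDl.
  apply: lerD; last exact: hL.
  by rewrite mulrAC; apply: cnorm_mul_le; rewrite ?hL.
Qed.

(** The compression [p v q] satisfies the two exact relations, and its defect
    is [q (q - v^* p v) q], which is at most the error of [v]. *)
Lemma exact_of_subequivalence_error p q v : projection p -> projection q ->
  cnorm v <= 1 -> subequivalence_error p q v <= 2^-1 ->
  exists2 v, star v ** v = q & p ** v = v /\ v ** q = v.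
Proof.
move=> hp hq v1 err; have [ps pp] := hp; have [qs qq] := hq.
have p1 := cnorm_projection_le1 hp; have q1 := cnorm_projection_le1 hq.
apply: (@exact_of_near_isometry p q (p ** v ** q)) => //.
- by rewrite !cmulA pp.
- by rewrite -cmulA qq.
apply: le_trans err.
have inner : - (star v ** v - q) - star v ** (p ** v - v) =
    q - star v ** p ** v.
  by rewrite cmulBr !opprB subrKA cmulA.
have -> : isometry_defect q (p ** v ** q) =
    q ** (- (star v ** v - q) - star v ** (p ** v - v)) ** q.
  rewrite inner /isometry_defect !starM ps qs cmulBr cmulBl !cmulA !qq.
  by rewrite -[_ ** p ** p]cmulA pp.
rewrite -[leRHS]mulr1; apply: cnorm_mul_le => //.
rewrite -[leRHS]mul1r; apply: cnorm_mul_le => //.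
apply: le_trans (cnormD _ _) _; rewrite !cnormN; apply: lerD => //.
by rewrite -[leRHS]mul1r; apply: cnorm_mul_le; rewrite ?cnorm_adj.
Qed.

Lemma subprojection_of_isometry p v : projection (star v ** v) -> p ** v = v ->
  v ** (star v ** v) = v ->
  projection (v ** star v) /\ p ** (v ** star v) = v ** star v.
Proof.
move=> hq pv vq; split; last by rewrite cmulA pv.
by split; [rewrite starM starK | rewrite cmulA -[_ ** v]cmulA vq].
Qed.

(** The trace is monotone here because [p - r] is a projection, hence of the
    form [z^* z]. *)
Lemma trace_subprojection (tr : {scalar A}) p r : tracial_state tr ->
  projection p -> projection r -> p ** r = r -> tr r <= tr p.
Proof.
move=> [tr0 _ _] [ps pp] [rs rr] pr.
have rp : r ** p = r by rewrite -{1}rs -{1}ps -starM pr.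
rewrite -subr_ge0 -linearB.
have -> : p - r = star (p - r) ** (p - r); last exact: tr0.
by rewrite starB ps rs cmulBl !cmulBr pp pr rp rr subrr subr0.
Qed.

End Correction.

(** * The quantity measured by the sentence *)

Section Gap.
Variables (R : realType) (A : cstarAlgType R).

Definition comparison_gap (x y v : A) : R :=
  let a := star x ** x in let b := star y ** y in
  Num.min (subequivalence_error a b v) (subequivalence_error b a v)
  - 128 * (cnorm (a ** a - a) + cnorm (b ** b - b)).

Lemma subequivalence_error_ge0 (a b v : A) : 0 <= subequivalence_error a b v.
Proof. by rewrite addr_ge0 ?cnorm_ge0. Qed.

Lemma subequivalence_error0 (a b : A) : subequivalence_error a b 0 = cnorm b.
Proof.
by rewrite /subequivalence_error !cmulr0 subr0 cnorm0 addr0 sub0r cnormN.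
Qed.

(** At [v = 0] the gap is at most [|a|] minus the penalty. The hypothesis
    makes the penalty at least 2, which settles the case [|a| <= 2]; beyond that
    [|a^2 - a| >= |a|^2 - |a| >= |a|], so the penalty still dominates. *)
Lemma comparison_gap_trivial (x y : A) :
  64^-1 <= cnorm (star x ** x ** (star x ** x) - star x ** x) +
           cnorm (star y ** y ** (star y ** y) - star y ** y) ->
  comparison_gap x y 0 <= 4^-1.
Proof.
rewrite /comparison_gap !subequivalence_error0.
set a := star x ** x; set b := star y ** y => large.
have as_ : star a = a by rewrite starM starK.
have a2 : cnorm (a ** a) = cnorm a ^+ 2 by rewrite -cnorm_starx as_.
have := cdist_norm (a ** a) a; rewrite a2.
have := ler_norm (cnorm a ^+ 2 - cnorm a).
have : Num.min (cnorm b) (cnorm a) <= cnorm a by rewrite ge_min lexx orbT.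
have := cnorm_ge0 a; have := cnorm_ge0 (b ** b - b); move: large.
move: `|cnorm a ^+ 2 - cnorm a| (cnorm (a ** a - a)) (cnorm (b ** b - b))
  (cnorm a) (Num.min (cnorm b) (cnorm a)).
clear; move=> N s2 t s m h t0 s0 ms sN Ns.
by have [s1|s1] := lerP s 2; nra.
Qed.

Lemma comparison_gap_small (x y v : A) :
  subequivalence_error (star x ** x) (star y ** y) v <= 4^-1 \/
  subequivalence_error (star y ** y) (star x ** x) v <= 4^-1 ->
  comparison_gap x y v <= 4^-1.
Proof.
move=> h; rewrite lerBlDr ler_wpDr ?mulr_ge0 ?ler0n ?addr_ge0 ?cnorm_ge0//.
by rewrite ge_min; case: h => ->; rewrite ?orbT.
Qed.

End Gap.

(** * Comparison in matrix algebras *)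

Section MatrixComparison.
Variable R : realType.
Local Open Scope sesquilinear_scope.
Local Notation nc := (@Normc.normc R).
Local Notation C := R[i].

Lemma opnorm_diag_le n (d : 'rV[C]_n) (c : R) : 0 <= c ->
  (forall j, nc (d 0 j) <= c) -> opnorm (diag_mx d) <= c.
Proof.
move=> c0 dc; apply: opnorm_lub => // x.
rewrite -(@ler_pXn2r _ 2) ?nnegrE ?mulr_ge0 ?vnorm_ge0// exprMn !sqr_vnorm.
rewrite mulr_sumr; apply: ler_sum => i _.
rewrite mul_diag_mx mxE Normc.normcM exprMn ler_wpM2r ?sqr_ge0//.
by rewrite ler_pXn2r ?nnegrE ?normc_ge0.
Qed.

Lemma opnorm_unitary n (U : 'M[C]_n) : U \is unitarymx -> opnorm U <= 1.
Proof.
move=> /unitarymxP UU; rewrite -opnorm_adj.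
rewrite -[_ <= _](@ler_pXn2r _ 2) ?nnegrE ?opnorm_ge0//.
rewrite -opnorm_cstar trmxCK UU -diag_const_mx expr1n.
apply: opnorm_diag_le => // j.
by rewrite mxE Normc.normc1.
Qed.

Lemma opnorm_mul_le n m p (M : 'M[C]_(n, m)) (N : 'M[C]_(m, p)) (c d : R) :
  opnorm M <= c -> opnorm N <= d -> opnorm (M *m N) <= c * d.
Proof.
move=> Mc Nd; apply: le_trans (opnormM _ _) _.
by apply: ler_pM => //; exact: opnorm_ge0.
Qed.

Lemma opnorm_unitary_mul n (U W X : 'M[C]_n) (c : R) :
  U \is unitarymx -> W \is unitarymx -> opnorm X <= c ->
  opnorm (U *m X *m W) <= c.
Proof.
move=> /opnorm_unitary U1 /opnorm_unitary W1 Xc.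
by have := opnorm_mul_le (opnorm_mul_le U1 Xc) W1; rewrite mul1r mulr1.
Qed.

Lemma normc_opp (z : C) : nc (- z) = nc z.
Proof. by case: z => a b /=; rewrite !sqrrN. Qed.

Lemma injection_of_card_le (T : finType) (A B : {set T}) : (#|A| <= #|B|)%N ->
  exists2 f : T -> T, {in A, forall x, f x \in B} & {in A &, injective f}.
Proof.
move=> AB; pose f x := nth x (enum B) (index x (enum A)).
have lt x : x \in A -> (index x (enum A) < size (enum B))%N.
  by move=> xA; rewrite -cardE (leq_trans _ AB)// cardE index_mem mem_enum.
exists f => [x xA|x y xA yA]; first by rewrite -mem_enum mem_nth// lt.
rewrite /f (set_nth_default y) ?lt// => /eqP.
rewrite nth_uniq ?enum_uniq ?lt// => /eqP h.
by apply: (index_inj x) h; rewrite mem_enum.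
Qed.

(** Since [z^2 - z = (z - 1) z], one of the factors is at most [8^-1]. *)
Lemma near_idempotent_scalar (z : C) : nc (z ^+ 2 - z) < 64^-1 ->
  nc (z - 1) <= 8^-1 \/ nc z <= 8^-1.
Proof.
have -> : z ^+ 2 - z = (z - 1) * z by rewrite mulrBl mul1r expr2.
rewrite Normc.normcM => h; case: (lerP (nc (z - 1)) 8^-1) => h1; first by left.
right; case: lerP => // h2; exfalso; move: h; apply/negP; rewrite -leNgt.
have -> : (64^-1 : R) = 8^-1 * 8^-1 by lra.
by apply: ler_pM; rewrite ?invr_ge0 ?ler0n ?(ltW h1) ?(ltW h2).
Qed.

(** In an orthonormal eigenbasis the entries of [A^2 - A] are [d_j^2 - d_j], so
    every eigenvalue is nearly a root of [z^2 - z]. *)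
Lemma spectral_near_idempotent n (A : 'M[C]_n) : A ^t* = A ->
  opnorm (A *m A - A) < 64^-1 ->
  exists U : 'M[C]_n, exists d : 'rV[C]_n,
    [/\ U \is unitarymx, A = U^t* *m diag_mx d *m U &
        forall j, nc (d 0 j - 1) <= 8^-1 \/ nc (d 0 j) <= 8^-1].
Proof.
move=> AA small.
have /orthomx_spectralP : A \is normalmx by apply/normalmxP; rewrite AA.
set U := spectralmx A; set d := spectral_diag A.
have UU : U \is unitarymx by exact: spectral_unitarymx.
rewrite invmx_unitary// => def; exists U, d; split => // j.
apply: near_idempotent_scalar; apply: le_lt_trans small.
have UP := unitarymxP UU.
have D : U *m (A *m A - A) *m U^t* = diag_mx (\row_j (d 0 j ^+ 2 - d 0 j)).
  have step : U *m A *m U^t* = diag_mx d.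
    by rewrite def !mulmxA UP mul1mx -mulmxA UP mulmx1.
  have -> : U *m (A *m A - A) *m U^t* = diag_mx d *m diag_mx d - diag_mx d.
    rewrite mulmxBr mulmxBl step -step !mulmxA; congr (_ - _).
    by rewrite mulmxKtV//.
  rewrite mulmx_diag -raddfB; congr diag_mx.
  by apply/rowP => k; rewrite !mxE expr2.
apply: (@le_trans _ _ (opnorm (U *m (A *m A - A) *m U^t*))).
  apply: le_trans (entry_opnorm _ j j).
  by rewrite D !mxE eqxx mulr1n.
by apply: opnorm_unitary_mul; rewrite ?trmxC_unitary.
Qed.

Definition near_one n (d : 'rV[C]_n) : {set 'I_n} :=
  [set j | nc (d 0 j - 1) <= 8^-1].

(** Let [T] index the eigenvalues of [B] near 1, and let [f] map [T] injectively
    to the indices of eigenvalues of [A] near 1. Sending the [j]-th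
    eigenvector of [B] to the [f j]-th one of [A] for [j] in [T], and the others
    to 0, is a partial isometry [v]: in the eigenbases [v^* v] is the indicator
    of [T] and [A v - v] is [v] times a diagonal matrix, so that both errors
    are read off from eigenvalues. *)
Lemma matrix_subequivalence n (A B U W : 'M[C]_n) (d e : 'rV[C]_n) :
  U \is unitarymx -> W \is unitarymx ->
  A = U^t* *m diag_mx d *m U -> B = W^t* *m diag_mx e *m W ->
  (forall j, nc (d 0 j - 1) <= 8^-1 \/ nc (d 0 j) <= 8^-1) ->
  (forall j, nc (e 0 j - 1) <= 8^-1 \/ nc (e 0 j) <= 8^-1) ->
  (#|near_one e| <= #|near_one d|)%N ->
  exists2 v : 'M[C]_n, opnorm v <= 1 &
    opnorm (v^t* *m v - B) + opnorm (A *m v - v) <= 4^-1.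
Proof.
move=> UU WU defA defB dP eP /injection_of_card_le[f fS finj].
set T := near_one e in fS finj.
pose t : 'rV[C]_n := \row_j (j \in T)%:R.
pose M : 'M[C]_n := \matrix_(i, j) ((j \in T) && (i == f j))%:R.
have MM : M^t* *m M = diag_mx t.
  apply/matrixP => j k; rewrite !mxE.
  under eq_bigr => i _ do rewrite !mxE rmorph_nat -natrM mulnb.
  have [jT|jT] := boolP (j \in T); last first.
    by rewrite big1// mul0rn.
  rewrite (bigD1 (f j))//= big1 => [|i /negPf ->//]; rewrite eqxx/= addr0.
  have [jk|jk] := eqVneq j k; first by rewrite -jk jT eqxx.
  rewrite mulr0n; case: (boolP (k \in T)) => //= kT.
  by case: eqP => // /finj -/(_ jT kT) h; rewrite h eqxx in jk.
have M1 : opnorm M <= 1.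
  rewrite -[_ <= _](@ler_pXn2r _ 2) ?nnegrE ?opnorm_ge0//.
  rewrite -opnorm_cstar MM expr1n.
  apply: opnorm_diag_le => // j; rewrite mxE; case: (_ \in _).
    by rewrite Normc.normc1.
  by rewrite Normc.normc0.
have UsU : U^t* \is unitarymx by rewrite trmxC_unitary UU.
have WsU : W^t* \is unitarymx by rewrite trmxC_unitary WU.
have UP := unitarymxP UU.
have e8 : (0 : R) <= 8^-1 by rewrite invr_ge0 ler0n.
have quarter : (4^-1 : R) = 8^-1 + 8^-1 by clear; lra.
exists (U^t* *m M *m W).
  exact: opnorm_unitary_mul UsU WU M1.
rewrite quarter; apply: lerD.
  have -> : (U^t* *m M *m W)^t* *m (U^t* *m M *m W) - B =
      W^t* *m diag_mx (t - e) *m W.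
    rewrite defB !trmx_mul !map_mxM trmxCK !mulmxA.
    rewrite -[_ *m U *m U^t*]mulmxA UP mulmx1 -[_ *m _ *m M]mulmxA MM.
    by rewrite -mulmxBl -mulmxBr -raddfB.
  apply: (opnorm_unitary_mul WsU WU).
  apply: opnorm_diag_le => [//|j]; rewrite !mxE inE.
  have [h|/negPf h] := boolP (nc (e 0 j - 1) <= 8^-1).
    by rewrite -normc_opp opprB.
  by rewrite sub0r normc_opp; case: (eP j) => //; rewrite h.
(* [(d - 1) M = M g]: left multiplication scales row [f j], right
   multiplication scales column [j], and [M] lives at the entries [(f j, j)]. *)
pose g : 'rV[C]_n := \row_j (if j \in T then d 0 (f j) - 1 else 0).
have -> : A *m (U^t* *m M *m W) - U^t* *m M *m W =
    U^t* *m (M *m diag_mx g) *m W.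
  rewrite defA !mulmxA -[_ *m U *m U^t*]mulmxA UP mulmx1.
  rewrite -mulmxBl; congr (_ *m W).
  rewrite -!mulmxA -mulmxBr; congr (_ *m _).
  apply/matrixP => i j; rewrite mul_diag_mx mul_mx_diag !mxE.
  case: (boolP (j \in T)) => jT /=; last by rewrite !mulr0n ?mul0r ?mulr0 subr0.
  case: eqP => [->|_]; last by rewrite mul0r mulr0 subr0.
  by rewrite mul1r mulr1.
apply: (opnorm_unitary_mul UsU WU); rewrite -[leRHS]mul1r.
apply: (opnorm_mul_le M1).
apply: opnorm_diag_le => [//|j]; rewrite mxE.
by case: ifP => [/fS|_]; rewrite ?inE ?Normc.normc0.
Qed.

Lemma matrix_comparison n (x y : mxalg R n) :
  exists2 v : mxalg R n, cnorm v <= 1 & comparison_gap x y v <= 4^-1.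
Proof.
have [large|small] := lerP 64^-1
  (cnorm (star x ** x ** (star x ** x) - star x ** x) +
   cnorm (star y ** y ** (star y ** y) - star y ** y)).
  by exists 0; [rewrite cnorm0 ler01 | exact: comparison_gap_trivial].
have spec (z : mxalg R n) :
    cnorm (star z ** z ** (star z ** z) - star z ** z) < 64^-1 ->
    exists U : 'M[R[i]]_n, exists d : 'rV[R[i]]_n,
    [/\ U \is unitarymx, (star z ** z : 'M[R[i]]_n) = U^t* *m diag_mx d *m U &
    forall j, Normc.normc (d 0 j - 1) <= 8^-1 \/ Normc.normc (d 0 j) <= 8^-1].
  move=> hz; apply: spectral_near_idempotent; last exact: hz.
  by have := starM (star z) z; rewrite starK.
have [|U [d [UU defA dP]]] := spec x.
  by apply: le_lt_trans small; rewrite lerDl cnorm_ge0.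
have [|W [e [WU defB eP]]] := spec y.
  by apply: le_lt_trans small; rewrite lerDr cnorm_ge0.
have [le|/ltnW le] := leqP #|near_one e| #|near_one d|.
  have [v v1 hv] := matrix_subequivalence UU WU defA defB dP eP le.
  by exists v => //; apply: comparison_gap_small; left.
have [v v1 hv] := matrix_subequivalence WU UU defB defA eP dP le.
by exists v => //; apply: comparison_gap_small; right.
Qed.

End MatrixComparison.

(** * Passage to ultraproducts *)

Section Ultraproducts.
Local Open Scope classical_set_scope.

Lemma cvg_min (R : realType) (T : Type) (F : set_system T)
    {FF : ProperFilter F} (f g : T -> R) (a b : R) :
  f x @[x --> F] --> a -> g x @[x --> F] --> b ->
  Num.min (f x) (g x) @[x --> F] --> Num.min a b.
Proof.
move=> fa gb; rewrite minr_absE; under eq_fun do rewrite minr_absE.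
apply: cvgMr_tmp; apply: cvgB; first exact: cvgD.
by apply: cvg_norm; exact: cvgB.
Qed.

Section UltraproductComparison.
Variables (R : realType) (J : Type) (U : set_system J) (UU : UltraFilter U).
Variable B : J -> cstarAlgType R.
Local Notation Q := (ultraproduct UU B).
Local Notation fam := (bounded_family B).
Local Notation pi a := (\pi_Q a)%qT.

Lemma ultra_mulE (a b : fam) : pi a ** pi b = pi (famM a b) :> Q.
Proof. exact: ultraME. Qed.

Lemma ultra_starE (a : fam) : star (pi a) = pi (famS a) :> Q.
Proof. exact: ultraSE. Qed.

Lemma ultra_subE (a b : fam) : pi a - pi b = pi (famD a (famN b)) :> Q.
Proof. by rewrite -ultraDE -ultraNE. Qed.

Lemma cnorm_ultra_cvg (a : fam) : cnorm (a i) @[i --> U] --> cnorm (pi a : Q).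
Proof. by rewrite /cnorm ultra_normE; exact: ultranorm_cvg. Qed.

Lemma subequivalence_error_cvg (a b v : fam) :
  subequivalence_error (a i) (b i) (v i) @[i --> U] -->
  subequivalence_error (pi a : Q) (pi b) (pi v).
Proof.
rewrite /subequivalence_error ultra_starE !ultra_mulE !ultra_subE.
by apply: cvgD; exact: cnorm_ultra_cvg.
Qed.

Lemma comparison_gap_cvg (x y v : fam) :
  comparison_gap (x i) (y i) (v i) @[i --> U] -->
  comparison_gap (pi x : Q) (pi y) (pi v).
Proof.
rewrite /comparison_gap !ultra_starE !ultra_mulE !ultra_subE.
apply: cvgB.
  apply: cvg_min; exact: subequivalence_error_cvg.
by apply: cvgMl_tmp; apply: cvgD; exact: cnorm_ultra_cvg.
Qed.

(** An instance of the theorem of Los: witnesses in the unit balls of the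
    factors assemble to a bounded family, whose class is a witness in the
    ultraproduct because the gap is continuous along [U]. *)
Lemma ultraproduct_comparison (c : R) :
  (forall i (x y : B i), exists2 v, cnorm v <= 1 & comparison_gap x y v <= c) ->
  forall x y : Q, exists2 v : Q, cnorm v <= 1 & comparison_gap x y v <= c.
Proof.
move=> h x y; rewrite -(reprK x) -(reprK y).
move: (repr x) (repr y) => {x y} a b.
have /(_ _)/cid2-/all_sig2[v v1 hv] := fun i => h i (a i) (b i).
have bv : exists c : R, forall i, cnorm (v i) <= c by exists 1.
pose V : fam := BoundedFamily bv; exists (pi V).
  exact: (filter_le_lim _ (@cnorm_ultra_cvg V) (cvg_cst (1 : R)) v1).
exact: (filter_le_lim _ (@comparison_gap_cvg a b V) (cvg_cst c) hv).
Qed.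

End UltraproductComparison.

End Ultraproducts.

(** * The sentence and its value *)

Section Sentence.
Local Open Scope classical_set_scope.
Variable R : realType.

Lemma env_cons0 (A : cstarAlgType R) n (x : A) (rho : 'I_n -> A) :
  env_cons x rho ord0 = x.
Proof. by rewrite /env_cons unlift_none. Qed.

Lemma env_consS (A : cstarAlgType R) n (x : A) (rho : 'I_n -> A) i :
  env_cons x rho (lift ord0 i) = rho i.
Proof. by rewrite /env_cons liftK. Qed.

Definition psub n (P Q : starpoly R n) := PAdd P (PScale (-1) Q).
Definition psquare n (P : starpoly R n) := PMul (PStar P) P.

(** The variables are, from the innermost quantifier outwards, [v], [y] and [x];
    the six polynomials are those whose norms [gap_connective] combines. *)
Definition gap_polys : seq (starpoly R 3) :=
  let v := PVar R ord0 in
  let a := psquare (PVar R (lift ord0 (lift ord0 ord0))) in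
  let b := psquare (PVar R (lift ord0 ord0)) in
  [:: psub (psquare v) b; psub (PMul a v) v; psub (psquare v) a;
      psub (PMul b v) v; psub (PMul a a) a; psub (PMul b b) b].

Definition entry (k : nat) (r : 'rV[R]_6) : R := r ord0 (inord k).

Definition gap_connective (r : 'rV[R]_6) : R :=
  Num.min (entry 0 r + entry 1 r) (entry 2 r + entry 3 r)
  - 128 * (entry 4 r + entry 5 r).

Lemma gap_connective_continuous : continuous gap_connective.
Proof.
move=> r; have FF : ProperFilter (nbhs r) := @nbhs_pfilter 'rV[R]_6 r.
have ce k : entry k x @[x --> r] --> entry k r.
  exact: coord_continuous.
have ce2 k l : entry k x + entry l x @[x --> r] --> entry k r + entry l r.
  exact: (@cvgD _ _ _ (nbhs r)).
apply: (@cvgB _ _ _ (nbhs r)).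
  exact: (@cvg_min _ _ (nbhs r)).
by apply: (@cvgMl_tmp _ _ (nbhs r)); exact: ce2.
Qed.

Definition gap_formula : formula R 3 :=
  FConn gap_connective_continuous
    (fun j => FNorm (nth (PVar R ord0) gap_polys j)).

Definition comparison_sentence : formula R 0 := FSup (FSup (FInf gap_formula)).

Lemma feval_gap_formula (A : cstarAlgType R) (x y v : A) rho :
  feval gap_formula (env_cons v (env_cons y (env_cons x rho))) =
  comparison_gap x y v.
Proof.
rewrite /= /gap_connective /entry !mxE !inordK//= !(env_consS, env_cons0).
by rewrite !scaleN1r.
Qed.

Section Value.
Variable A : cstarAlgType R.
Implicit Types x y v : A.

Definition infimal_gap x y : R :=
  inf [set comparison_gap x y v | v in @unit_ball R A].

Lemma comparison_sentenceE : sentence_value A (comparison_sentence) =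
  sup [set sup [set infimal_gap x y | y in @unit_ball R A]
      | x in @unit_ball R A].
Proof.
congr (sup _); apply: eq_imagel => x _; congr (sup _); apply: eq_imagel => y _.
by congr (inf _); apply: eq_imagel => v _; exact: feval_gap_formula.
Qed.

Lemma unit_ballP x : unit_ball x <-> cnorm x <= 1.
Proof. by rewrite /unit_ball /= cnormE (lecR _ 1). Qed.

Lemma unit_ball0 : unit_ball (0 : A).
Proof. by apply/unit_ballP; rewrite cnorm0 ler01. Qed.

(** An [inf] is a lower bound only of a set that is bounded below, here by minus
    the penalty. *)
Lemma infimal_gap_le x y v :
  cnorm v <= 1 -> infimal_gap x y <= comparison_gap x y v.
Proof.
move=> v1; apply: ge_inf; last by exists v => //; apply/unit_ballP.
exists (- (128 * (cnorm (star x ** x ** (star x ** x) - star x ** x) +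
                  cnorm (star y ** y ** (star y ** y) - star y ** y)))).
by move=> _ [w _ <-]; rewrite lerDr le_min !subequivalence_error_ge0.
Qed.

(** The uniform bound, attained at [v = 0], that makes the suprema defining the
    sentence those of bounded sets. *)
Lemma infimal_gap_le1 x y : cnorm y <= 1 -> infimal_gap x y <= 1.
Proof.
move=> y1; apply: le_trans (infimal_gap_le _ _ (_ : cnorm 0 <= 1)) _.
  by rewrite cnorm0 ler01.
rewrite /comparison_gap !subequivalence_error0.
rewrite lerBlDr ler_wpDr ?mulr_ge0 ?ler0n ?addr_ge0 ?cnorm_ge0//.
by rewrite ge_min cnorm_starx exprn_ile1 ?cnorm_ge0.
Qed.

Lemma comparison_sentence_le (c : R) :
  (forall x y, exists2 v, cnorm v <= 1 & comparison_gap x y v <= c) ->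
  sentence_value A comparison_sentence <= c.
Proof.
move=> h; rewrite comparison_sentenceE; have b0 := unit_ball0.
apply: ge_sup => [|_ [x _ <-]]; first by apply: image_nonempty; exists 0.
apply: ge_sup => [|_ [y _ <-]]; first by apply: image_nonempty; exists 0.
by have [v v1] := h x y; apply: le_trans; exact: infimal_gap_le.
Qed.

Lemma comparison_of_sentence (c d : R) x y :
  sentence_value A comparison_sentence <= c -> c < d ->
  cnorm x <= 1 -> cnorm y <= 1 ->
  exists2 v, cnorm v <= 1 & comparison_gap x y v < d.
Proof.
rewrite comparison_sentenceE => sc cd /unit_ballP x1 /unit_ballP y1.
have b0 := unit_ball0.
have ub z : ubound [set infimal_gap z y | y in @unit_ball R A] 1.
  by move=> _ [w /unit_ballP w1 <-]; exact: infimal_gap_le1.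
have le : infimal_gap x y <= c.
  apply: le_trans sc.
  apply: (@le_trans _ _ (sup [set infimal_gap x y | y in @unit_ball R A])).
    by apply: ub_le_sup; [exists 1; exact: ub | exists y].
  apply: ub_le_sup; last by exists x.
  exists 1 => _ [z _ <-]; apply: ge_sup; last exact: ub.
  by apply: image_nonempty; exists 0.
have [|_ [v /unit_ballP v1 <-] hv] := inf_lt _ (le_lt_trans le cd).
  by apply: image_nonempty; exists 0.
by exists v.
Qed.

End Value.
End Sentence.

(** * Strict comparison *)

Theorem proposition6p8 (R : realType) (A : cstarAlgType R)
    (hA : pseudomatricial A) (tr : {scalar A}) (htr : tracial_state tr)
    (p q : A) (hp : projection p) (hq : projection q) (hlt : tr q < tr p) :
  exists2 r : A, proper_subprojection r p & mvn_equivalent q r.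
Proof.
have [J [U [UU [n [_ AB]]]]] := hA.
have value : sentence_value A (comparison_sentence R) <= 4^-1.
  rewrite AB; apply: comparison_sentence_le.
  by apply: ultraproduct_comparison => i; exact: matrix_comparison.
have lt42 : (4^-1 : R) < 2^-1 by lra.
have [v v1] := comparison_of_sentence value lt42
  (cnorm_projection_le1 hp) (cnorm_projection_le1 hq).
have [ps pp] := hp; have [qs qq] := hq.
(* For projections the penalty vanishes. *)
rewrite /comparison_gap ps qs pp qq !pp !qq !subrr cnorm0 addr0 mulr0 subr0.
rewrite gt_min => /orP[/ltW err|/ltW err].
  have [w ww [pw wq]] := exact_of_subequivalence_error hp hq v1 err.
  have [hr pr] : projection (w ** star w) /\ p ** (w ** star w) = w ** star w.
    by apply: subprojection_of_isometry; rewrite ?ww.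
  exists (w ** star w); last by exists w; rewrite ww.
  split => // rp; have [_ _ trC] := htr.
  by move: hlt; rewrite -ww trC rp ltxx.
(* The other alternative contradicts [tr q < tr p]. *)
have [w ww [qw wp]] := exact_of_subequivalence_error hq hp v1 err.
have [hr qr] : projection (w ** star w) /\ q ** (w ** star w) = w ** star w.
  by apply: subprojection_of_isometry; rewrite ?ww.
have := trace_subprojection htr hq hr qr.
have [_ _ trC] := htr; rewrite -trC ww => h.
by have := lt_le_trans hlt h; rewrite ltxx.
Qed.
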